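(* For $n\ge2$ and a two-row matrix $\begin{pmatrix}a\\ b\end{pmatrix}\in M_{2\times q}(\mathbb N)$ with $q\le n$, define $\varphi_n\begin{pmatrix}a\\ b\end{pmatrix}=J_n\begin{pmatrix}a\\ b\end{pmatrix}/\Gamma_n\begin{pmatrix}a\\ b\end{pmatrix}$. Then, whenever $n$ is at least the number of columns of all matrices involved: (1) $\varphi_n\begin{pmatrix}a\\ b\end{pmatrix}=\varphi_n\begin{pmatrix}a&0\\ b&0\end{pmatrix}$; (2) $\varphi_n\begin{pmatrix}a\\ b\end{pmatrix}=\varphi_n\begin{pmatrix}b\\ a\end{pmatrix}$; (3) $\varphi_n$ is invariant under any permutation of the columns; (4) $\varphi_n\begin{pmatrix}a&c\\ b&d\end{pmatrix}=\varphi_n\begin{pmatrix}a&d\\ b&c\end{pmatrix}$ for all row vectors $a,b\in\mathbb N^q$, $c,d\in\mathbb N^s$; (5) $\varphi_n\begin{pmatrix}a&c\\ b&0\end{pmatrix}=\varphi_n\begin{pmatrix}a&\sum_i c_i\\ b&0\end{pmatrix}$ for $a,b\in\mathbb N^q$ and $c\in(2\mathbb N)^s$; (6) $\varphi_n\begin{pmatrix}a&c\\ b&0\end{pmatrix}=\varphi_{n+c}\begin{pmatrix}a\\ b\end{pmatrix}$ for $a,b\in\mathbb N^q$ and $c\in\mathbb N$; (7) $\varphi_n\begin{pmatrix}a&c\\ b&0\end{pmatrix}\in\{0,1\}$ for $a,b\in\mathbb N$ and $c\in\mathbb N^s$; (8) $\varphi_2\begin{pmatrix}a&c\\ b&d\end{pmatrix}\in\{-1,0,1\}$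 for $a,b,c,d\in\mathbb N$; (9) for $a,b,c,d\in\mathbb N$, $\varphi_n\begin{pmatrix}a&c\\ b&d\end{pmatrix}$ is invariant under all permutations of $(a,b,c,d)$.
   Context: For an integer $m\ge0$, $m!!$ denotes $(m-1)(m-3)\cdots$, the product of positive integers $\le m-1$ with the parity of $m-1$ (empty product $=1$). $O_n$ is the orthogonal group with Haar probability measure; for $a\in M_{p\times q}(\mathbb N)$, $p,q\le n$, $I_n(a)=\int_{O_n}\prod_{i,j}u_{ij}^{a_{ij}}\,du$, and $J_n(a)$ is defined by $I_n(a)=\frac{(n-1)!!\prod_{i,j}a_{ij}!!}{(\sum_{i,j}a_{ij}+n-1)!!}J_n(a)$. For a two-row matrix $\begin{pmatrix}a\\ b\end{pmatrix}=(x_{it})\in M_{2\times q}(\mathbb N)$ and $0\le r\le q$, let $P_r$ be the multiset of numbers $\sum_{t\in S}x_{i_t t}$, where $S$ ranges over the $r$-element subsets of $\{1,\dots,q\}$ and $(i_t)_{t\in S}$ over all maps $S\to\{1,2\}$ (so $P_r$ has $2^r\binom qr$ elements, and $P_0=\{0\}$). Writing $\langle M\rangle_n=\prod_{m\in M}(m+n-2)!!$ for a multiset $M$, and $A=\sum_t x_{1t}$, $B=\sum_t x_{2t}$, $$\Gamma_n\begin{pmatrix}a\\ b\end{pmatrix}=\frac{(n-2)!!\prod_{0\le r\le q,\ q-r\text{ even}}\langle P_r\rangle_n}{(A+n-2)!!\,(B+n-2)!!\prod_{0\le r\le q,\ q-r\text{ odd}}\langle P_r\rangle_n}.$$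
   Formalization: In (6) the integer c is assumed even; for odd c the identity fails, e.g. n=2, a=b=0 (one column), c=1, where the left side is 0 and the right side is 1. *)

(* Defs.v *)
From HB Require Import structures.
From mathcomp Require Import all_boot all_order all_algebra all_fingroup.
From mathcomp Require Import all_classical all_reals all_analysis.
Set Implicit Arguments.
Unset Strict Implicit.
Unset Printing Implicit Defensive.
Import Order.TTheory GRing.Theory Num.Theory.
Import numFieldNormedType.Exports.

Local Open Scope classical_set_scope.
Local Open Scope ring_scope.

(* m!! = (m-1)(m-3)(m-5)..., shifted by one from the usual double factorial:
   0!! = 1!! = 2!! = 1, 3!! = 2, 4!! = 3, 5!! = 8. *)
Definition dfact (m : nat) : nat :=
  (\prod_(1 <= k < m | odd k == odd m.-1) k)%N.

Definition borel_mx (R : realType) (n : nat) :=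
  g_sigma_algebraType (@open 'M[R]_n).

Definition orthogonal_group (R : realType) (n : nat) : set (borel_mx R n) :=
  [set u : 'M[R]_n | u *m u^T = 1%:M].
Arguments orthogonal_group : clear implicits.

(* The Haar probability measure of O_n, viewed as a Borel measure on the
   ambient space of matrices that is carried by the closed subset O_n. *)
Definition is_haar (R : realType) (n : nat)
    (mu : probability (borel_mx R n) R) : Prop :=
  mu (orthogonal_group R n) = 1%E /\
  forall (g : 'M[R]_n) (A : set (borel_mx R n)),
    orthogonal_group R n g -> measurable A ->
    mu [set u : borel_mx R n | A (g *m u)] = mu A.

Definition I_int (R : realType) (n : nat) (mu : probability (borel_mx R n) R)
    (p q : nat) (hp : (p <= n)%N) (hq : (q <= n)%N)
    (a : 'M[nat]_(p, q)) : R :=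
  \int[mu]_(u in orthogonal_group R n)
    \prod_(i < p) \prod_(j < q)
      ((u : 'M[R]_n) (widen_ord hp i) (widen_ord hq j)) ^+ a i j.

(* I_n(a) = (n-1)!! (prod a_ij!!) / (sum a_ij + n - 1)!! * J_n(a),
   solved for J_n(a). *)
Definition J_int (R : realType) (n : nat) (mu : probability (borel_mx R n) R)
    (p q : nat) (hp : (p <= n)%N) (hq : (q <= n)%N)
    (a : 'M[nat]_(p, q)) : R :=
  I_int mu hp hq a /
  ((dfact (n - 1) * \prod_(i < p) \prod_(j < q) dfact (a i j))%:R
   / (dfact (\sum_(i < p) \sum_(j < q) a i j + n - 1))%:R).

(* A multiset is represented by a sequence. *)
Definition P_multiset (q : nat) (x : 'M[nat]_(2, q)) (r : nat) : seq nat :=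
  flatten [seq [seq (\sum_(t : {t : 'I_q | t \in T}) x (i t) (val t))%N
                 | i : {ffun {t : 'I_q | t \in T} -> 'I_2}]
            | T : {set 'I_q} <- enum [set T : {set 'I_q} | #|T| == r]%SET].

Definition bracket (n : nat) (M : seq nat) : nat :=
  (\prod_(m <- M) dfact (m + n - 2))%N.

Definition Gamma_fac (R : realType) (n q : nat) (x : 'M[nat]_(2, q)) : R :=
  let A := (\sum_(t < q) x ord0 t)%N in
  let B := (\sum_(t < q) x ord_max t)%N in
  (dfact (n - 2)
     * \prod_(0 <= r < q.+1 | ~~ odd (q - r)) bracket n (P_multiset x r))%:R
  / (dfact (A + n - 2) * dfact (B + n - 2)
     * \prod_(0 <= r < q.+1 | odd (q - r)) bracket n (P_multiset x r))%:R.

Definition phi (R : realType) (n : nat) (mu : probability (borel_mx R n) R)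
    (q : nat) (hn : (2 <= n)%N) (hq : (q <= n)%N) (x : 'M[nat]_(2, q)) : R :=
  J_int mu hn hq x / Gamma_fac R n x.

(* The matrix with first row (a, c) and second row (b, d). *)
Definition mx22 (a c b d : nat) : 'M[nat]_2 :=
  block_mx (const_mx a : 'M[nat]_1) (const_mx c : 'M[nat]_1)
           (const_mx b : 'M[nat]_1) (const_mx d : 'M[nat]_1).

(* Main.v *)
(* The two-row moments of O_n have the closed form ([two_row_value])
     c_n Lambda_(A+B+n) (prod_k w_(a_k, b_k)) /
       ((A+n-2)!! (B+n-2)!! (A+B+n-1)!!),
   where w_(a,b)(z) counts the pairings of a + b points by their number of mixed
   pairs and Lambda_N(z^k) is, for k even, (-1)^(k/2) k!! (N-k-2)!!. This is what
   one gets by integrating two Gaussian vectors against delta(<x, y>). It is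
   proved without Gaussians: invariance under infinitesimal rotations of rows and
   columns, together with the orthonormality of the rows, gives a recursion which
   determines the moments and which Lambda satisfies by integration by parts.
   Invariance under columns comes from transpose invariance of Haar measure.
   On the other side, the quotient of the products of Gamma_n is the product of
   (m+n-2)!! over the signed multiset prod_t (X^(x_1t) + X^(x_2t) - 1). Thus
   phi_n = Lambda / (prod x_ij!! * signed product); each column enters through
   symmetric functions of its two entries, and an even column (c, 0) just replaces
   n by n + c. The last three properties follow by transposing a 2 x 2 matrix and,
   for n = 2, from (u_21, u_22) = det u * (- u_12, u_11). *)

Require Import Defs.
From HB Require Import structures.
From mathcomp Require Import all_boot all_order all_algebra all_fingroup.
From mathcomp Require Import all_classical all_reals all_analysis.
From mathcomp Require Import measurable_realfun.
From mathcomp Require Import ring zify.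
Import Order.TTheory GRing.Theory Num.Theory.
Import numFieldNormedType.Exports.
Set Implicit Arguments.
Unset Strict Implicit.
Unset Printing Implicit Defensive.
Local Open Scope classical_set_scope.
Local Open Scope ring_scope.

(** * Preliminaries on polynomials and the shifted double factorial *)

Lemma deriv_prod (R : comNzRingType) (I : finType) (F : I -> {poly R}) :
  (\prod_i F i)^`() = \sum_i (F i)^`() * \prod_(j | j != i) F j.
Proof.
suff gen (r : seq I) : uniq r -> (\prod_(i <- r) F i)^`() =
    \sum_(i <- r) (F i)^`() * \prod_(j <- r | j != i) F j.
  by rewrite gen ?index_enum_uniq.
elim: r => [|i r IH] /=; first by rewrite !big_nil derivC.
move=> /andP[ir ur]; rewrite !big_cons derivM IH// eqxx mulr_sumr.
congr (_ * _ + _).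
  rewrite big_seq [RHS]big_seq_cond; apply: eq_bigl => j.
  by case: eqP => [->|]; rewrite ?(negPf ir) ?andbT ?andbF.
rewrite big_seq [RHS]big_seq; apply: eq_bigr => j jr.
rewrite big_cons ifT; first by rewrite mulrCA.
by apply: contraNneq ir => ->.
Qed.

Lemma coef1_horner (R : nzRingType) (p : {poly R}) : p`_1 = p^`().[0].
Proof. by rewrite horner_coef0 coef_deriv mulr1n. Qed.

(** The difference of [p] and [p \Po (- 'X)] has more roots than its degree allows, hence is zero;
    comparing derivatives at 0 yields the claim. This later extracts a first-order relation from
    rotation invariance without differentiating under the integral. *)
Lemma even_poly_coef1 (R : numFieldType) (p : {poly R}) :
  (forall x, p.[x] = p.[- x]) -> p`_1 = 0.
Proof.
move=> pE; pose q := p - (p \Po (- 'X)).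
have q0 : q = 0.
  apply: (@roots_geq_poly_eq0 _ q [seq k%:R | k <- iota 0 (size q)]).
  - apply/allP => x _; rewrite /root /q !(hornerE, horner_comp).
    by rewrite -pE subrr.
  - by rewrite map_inj_uniq ?iota_uniq//; exact: mulrIn (oner_neq0 _).
  - by rewrite size_map size_iota.
have /eqP : p`_1 = - p`_1.
  have /(congr1 deriv) := subr0_eq q0.
  rewrite deriv_comp derivN derivX => /(congr1 (horner^~ 0)).
  by rewrite -coef1_horner hornerM horner_comp !hornerE oppr0 -coef1_horner mulrN1.
by rewrite -addr_eq0 -mulr2n mulrn_eq0 => /eqP.
Qed.

Lemma dfactSS m : dfact m.+2 = (m.+1 * dfact m)%N.
Proof.
rewrite /dfact big_mkcond big_nat_recr//= eqxx mulnC; congr (_ * _)%N.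
case: m => [|m]; first by rewrite !big_geq.
rewrite [RHS]big_mkcond/= big_nat_recr//= negbK.
by case: (odd m); rewrite /= muln1.
Qed.

Lemma dfact_gt0 m : (0 < dfact m)%N.
Proof.
rewrite /dfact big_seq_cond; apply: prodn_cond_gt0 => k.
by rewrite mem_index_iota => /andP[/andP[]].
Qed.

Lemma dfact0 : dfact 0 = 1%N. Proof. by rewrite /dfact big_geq. Qed.

(** * Pairing polynomials and the beta functional *)

Section Pairings.
Variable R : numFieldType.
Implicit Types (a b c k : nat) (p q : {poly R}).

(* The coefficient of ['X^k] counts the pairings of a points of one colour and
   b of another with exactly k bichromatic pairs; this is E[x^a y^b] for a
   standard Gaussian pair of covariance ['X]. *)
Fixpoint pairing a b : {poly R} :=
  if a is a'.+1 then
    (if a' is a''.+1 then a'%:R * pairing a'' b else 0) +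
    b%:R * 'X * pairing a' b.-1
  else if odd b then 0 else (dfact b)%:R.

Lemma pairingS a b : pairing a.+1 b =
  a%:R * pairing a.-1 b + b%:R * 'X * pairing a b.-1.
Proof. by case: a => //=; rewrite mul0r. Qed.

Lemma pairing0S b : pairing 0 b.+1 = b%:R * pairing 0 b.-1.
Proof.
case: b => [|b] /=; first by rewrite mul0r.
by rewrite negbK; case: odd; rewrite ?mulr0// dfactSS natrM.
Qed.

Lemma pairing0 b : pairing 0 b = if odd b then 0 else (dfact b)%:R.
Proof. by []. Qed.

#[global] Arguments pairing : simpl never.

(** The definition removes a point of the first colour together with its partner; here a point of
    the second colour is removed instead. This is the step towards the symmetry [pairingC]. *)
Lemma pairing_Sr a b : pairing a b.+1 =
  b%:R * pairing a b.-1 + a%:R * 'X * pairing a.-1 b.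
Proof.
elim/ltn_ind: a b => -[|a] IH b.
  by rewrite pairing0S !mul0r addr0.
rewrite !pairingS /=.
(* Each expansion is stated with its integer coefficient in front, so that the case where a
   predecessor is truncated at 0 is trivial. *)
have E1 : b%:R * pairing a b =
    b%:R * ((b.-1)%:R * pairing a b.-2 + a%:R * 'X * pairing a.-1 b.-1).
  by case: b => [|b]; rewrite ?mul0r// (IH a).
have E2 : a%:R * pairing a.-1 b.+1 =
    a%:R * (b%:R * pairing a.-1 b.-1 + (a.-1)%:R * 'X * pairing a.-2 b).
  case: a IH {E1} => [|a] IH; rewrite ?mul0r// (IH a)//.
have E3 : a%:R * pairing a b =
    a%:R * ((a.-1)%:R * pairing a.-2 b + b%:R * 'X * pairing a.-1 b.-1).
  by case: a {IH E1 E2} => [|a]; rewrite ?mul0r// pairingS.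
rewrite E2 !mulrS !mulrDl !mul1r.
have -> : b%:R * 'X * pairing a b = 'X * (b%:R * pairing a b) by ring.
have -> : a%:R * 'X * pairing a b = 'X * (a%:R * pairing a b) by ring.
rewrite E1 E3; ring.
Qed.

Lemma pairingC a b : pairing a b = pairing b a.
Proof.
elim/ltn_ind: a b => -[|[|a]] IH b; last first.
- rewrite pairingS pairing_Sr /= (IH a)//.
  by case: b => [|b]; rewrite ?mul0r// (IH a.+1).
- rewrite pairingS pairing_Sr !mul0r !add0r.
  by case: b => [|b]; rewrite ?mul0r// (IH 0%N).
elim/ltn_ind: b {IH} => -[//|b] IH.
rewrite pairing0S pairingS /= !mul0r addr0.
by case: b IH => [|b] IH; rewrite ?mul0r// IH.
Qed.

Lemma pairing0r a : pairing a 0 = if odd a then 0 else (dfact a)%:R.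
Proof. by rewrite pairingC pairing0. Qed.

(** Differentiating marks one mixed pair and removes it: its two ends can be chosen in a * b
    ways. *)
Lemma deriv_pairing a b : (pairing a b)^`() = (a * b)%:R * pairing a.-1 b.-1.
Proof.
elim/ltn_ind: a b => -[|a] IH b.
  by rewrite mul0n mul0r pairing0; case: odd; rewrite ?deriv0 -?polyC_natr ?derivC.
rewrite pairingS derivD !derivM !derivX (IH a)//.
have IHa : a%:R * (pairing a.-1 b)^`() =
    a%:R * ((a.-1 * b)%:R * pairing a.-2 b.-1).
  by case: a IH => [|a] IH; rewrite ?mul0r// IH.
have Ea : a%:R * pairing a b.-1 = a%:R * ((a.-1)%:R * pairing a.-2 b.-1 +
    (b.-1)%:R * 'X * pairing a.-1 b.-2).
  by case: a {IH IHa} => [|a]; rewrite ?mul0r// pairingS.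
have d0 m : (m%:R : {poly R})^`() = 0 by rewrite -polyC_natr derivC.
rewrite !d0 IHa mulSn natrD [RHS]mulrDl /=.
have -> : (a * b)%:R * pairing a b.-1 = b%:R * (a%:R * pairing a b.-1).
  by rewrite natrM; ring.
by rewrite Ea !natrM; ring.
Qed.

Lemma size_mulrn_leq p k : (size (p *+ k) <= size p)%N.
Proof. by rewrite -scaler_nat size_scale_leq. Qed.

Lemma pairing_size a b : (size (pairing a b) <= a.+1)%N.
Proof.
elim/ltn_ind: a b => -[|a] IH b.
  by rewrite pairing0; case: odd; rewrite ?size_poly0// -polyC_natr size_polyC; case: eqP.
rewrite pairingS; apply: leq_trans (size_polyD _ _) _; rewrite geq_max; apply/andP; split.
  rewrite mulr_natl; apply: leq_trans (size_mulrn_leq _ _) _.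
  by apply: leq_trans (IH _ _ _) _; lia.
have -> : b%:R * 'X * pairing a b.-1 = (pairing a b.-1 *+ b) * 'X.
  by rewrite -[_ *+ b]mulr_natl; ring.
have [->|p0] := eqVneq (pairing a b.-1 *+ b) 0.
  by rewrite mul0r size_poly0.
rewrite size_mulX// ltnS; apply: leq_trans (IH a _ _) => //.
exact: size_mulrn_leq.
Qed.

(** Points of the first colour outside mixed pairs are matched among themselves, so the number of
    mixed pairs has the parity of a. *)
Lemma pairing_opp a b : pairing a b \Po (- 'X) = (-1) ^+ a * pairing a b.
Proof.
elim/ltn_ind: a b => -[|a] IH b.
  rewrite pairing0 expr0 mul1r; case: odd; first by rewrite comp_poly0.
  by rewrite -polyC_natr comp_polyC.
have cn m : (m%:R : {poly R}) \Po (- 'X) = m%:R.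
  by rewrite -polyC_natr comp_polyC.
rewrite pairingS comp_polyD !comp_polyM !cn comp_polyX (IH a)// exprS.
have -> : a%:R * (pairing a.-1 b \Po - 'X) = - (-1) ^+ a * (a%:R * pairing a.-1 b).
  case: a IH => [|a] IH; first by rewrite !mul0r mulr0.
  by rewrite IH//= exprS; ring.
ring.
Qed.

(** Recolouring one point, the effect of an infinitesimal row rotation, becomes a first-order
    differential operator. Its leading term is the one that [beta_by_parts] handles. *)
Lemma pairing_shift a b : a%:R * pairing a.-1 b.+1 =
  (1 - 'X ^+ 2) * (pairing a b)^`() + a%:R * 'X * pairing a b.
Proof.
rewrite pairing_Sr deriv_pairing.
case: a => [|a]; first by rewrite mul0n !mul0r mulr0 addr0.
by rewrite pairingS natrM /=; ring.
Qed.

(** * The beta functional *)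

(* Up to a factor depending on N only, the integral of z^k (1 + t^2)^(-N/2)
   over the real t, where z = it. *)
Definition beta_weight (N k : nat) : R :=
  if odd k then 0 else (-1) ^+ k./2 * (dfact k * dfact (N - k - 2))%:R.

Definition beta (N : nat) p : R := \sum_(k < size p) p`_k * beta_weight N k.

Lemma beta_wide N p m : (size p <= m)%N ->
  beta N p = \sum_(k < m) p`_k * beta_weight N k.
Proof.
move=> pm; rewrite /beta (big_ord_widen m (fun k => p`_k * beta_weight N k))//.
rewrite big_mkcond; apply: eq_bigr => k _; case: ltnP => // sk.
by rewrite nth_default ?mul0r.
Qed.

Lemma betaD N p q : beta N (p + q) = beta N p + beta N q.
Proof.
pose m := maxn (size p) (size q).
rewrite (@beta_wide _ (p + q) m) ?size_polyD//.
rewrite (@beta_wide _ p m) ?leq_maxl// (@beta_wide _ q m) ?leq_maxr//.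
by rewrite -big_split; apply: eq_bigr => k _; rewrite coefD mulrDl.
Qed.

Lemma betaZ N (c : R) p : beta N (c *: p) = c * beta N p.
Proof.
rewrite (@beta_wide _ _ (size p)) ?size_scale_leq// mulr_sumr.
by apply: eq_bigr => k _; rewrite coefZ mulrA.
Qed.

Lemma betaN N p : beta N (- p) = - beta N p.
Proof. by rewrite -scaleN1r betaZ mulN1r. Qed.

Lemma beta0 N : beta N 0 = 0.
Proof. by rewrite /beta size_poly0 big_ord0. Qed.

Lemma beta_sum N I (r : seq I) (F : I -> {poly R}) :
  beta N (\sum_(i <- r) F i) = \sum_(i <- r) beta N (F i).
Proof. exact: (big_morph _ (betaD N) (beta0 N)). Qed.

Lemma beta_natl N k p : beta N (k%:R * p) = k%:R * beta N p.
Proof. by rewrite -polyC_natr mul_polyC betaZ. Qed.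

Lemma betaXn N k : beta N 'X^k = beta_weight N k.
Proof.
rewrite /beta size_polyXn big_ord_recr/= coefXn eqxx mul1r big1 ?add0r// => i _.
by rewrite coefXn ltn_eqF ?mul0r.
Qed.

Lemma betaC N (c : R) : beta N c%:P = c * (dfact (N - 2))%:R.
Proof.
rewrite -[c%:P]mulr1 mul_polyC betaZ; have := betaXn N 0; rewrite expr0 => ->.
by rewrite /beta_weight /= dfact0 expr0 mul1r mul1n subn0.
Qed.

Lemma betaM N p q :
  beta N (p * q) = \sum_(k < size p) p`_k * beta N ('X^k * q).
Proof.
rewrite -[p in LHS]coefK poly_def mulr_suml beta_sum; apply: eq_bigr => k _.
by rewrite -scalerAl betaZ.
Qed.

Lemma beta_odd N p : p \Po (- 'X) = - p -> beta N p = 0.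
Proof.
move=> pX; rewrite /beta big1// => k _; rewrite /beta_weight.
case: ifP => ok; first by rewrite mulr0.
suff -> : p`_k = 0 by rewrite mul0r.
have : (p \Po (- 'X))`_k = p`_k.
  rewrite coef_comp_poly (bigD1 k)//= big1 => [|i ik].
    by rewrite addr0 exprNn coefMXn ltnn subnn -signr_odd ok expr0 coef1 mulr1.
  rewrite exprNn -polyC1 -polyCN -polyC_exp coefCM coefXn.
  by rewrite -val_eqE /= eq_sym in ik; rewrite (negPf ik) !mulr0.
rewrite pX coefN => /eqP; rewrite eq_sym -addr_eq0 -mulr2n mulrn_eq0.
by move=> /eqP.
Qed.

(** Integration by parts on monomials. The bound makes the truncated subtractions exact, so that
    [dfactSS] applies to both factors. *)
Lemma beta_weightSS N k : (k + 4 <= N)%N ->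
  (N%:R - k%:R - 3) * beta_weight N k.+2 = - (k%:R + 1) * beta_weight N k.
Proof.
move=> kN; rewrite /beta_weight /= negbK; case: ifP => _; first by rewrite !mulr0.
have -> : (N - k.+2 - 2 = N - k - 4)%N by lia.
have -> : (N - k - 2 = (N - k - 4).+2)%N by lia.
rewrite !dfactSS -(subnKC kN) !natrM !natrD exprS mulN1r.
have -> : (k + 4 + (N - (k + 4)) - k - 4 = N - (k + 4))%N by lia.
by rewrite -!natr1; ring.
Qed.

Lemma beta_weight_lower N k : (k + 4 <= N)%N ->
  (N%:R - 2) * beta_weight (N - 2) k = beta_weight N k - beta_weight N k.+2.
Proof.
move=> kN; rewrite /beta_weight /= negbK; case: ifP => _; first by rewrite mulr0 subr0.
have -> : (N - k.+2 - 2 = N - k - 4)%N by lia.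
have -> : (N - 2 - k - 2 = N - k - 4)%N by lia.
have -> : (N - k - 2 = (N - k - 4).+2)%N by lia.
rewrite !dfactSS -(subnKC kN) !natrM !natrD exprS mulN1r.
have -> : (k + 4 + (N - (k + 4)) - k - 4 = N - (k + 4))%N by lia.
by rewrite -!natr1; ring.
Qed.

(** With z = it, 1 - z^2 is 1 + t^2, so multiplying by it lowers the exponent N/2 by one; the factor
    N - 2 reflects the normalisation depending on N. *)
Lemma beta_lower N p : (size p + 3 <= N)%N ->
  (N%:R - 2) * beta (N - 2) p = beta N ((1 - 'X ^+ 2) * p).
Proof.
move=> pN; rewrite [X in beta N X]mulrC betaM {1}/beta mulr_sumr.
apply: eq_bigr => k _; rewrite mulrCA beta_weight_lower; last first.
  by have := ltn_ord k; lia.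
by congr (_ * _); rewrite mulrBr mulr1 -exprD addn2 betaD betaN !betaXn.
Qed.

(** The left side is the integral of the derivative of p(z) (1 - z^2)^(1 - N/2), checked here
    coefficient by coefficient. *)
Lemma beta_by_parts N p : (size p + 2 <= N)%N ->
  (N%:R - 2) * beta N ('X * p) + beta N ((1 - 'X ^+ 2) * p^`()) = 0.
Proof.
move=> pN.
have dE : p^`() = \sum_(k < size p) p`_k *: (k%:R *: 'X^(k.-1)).
  rewrite -[p in LHS]coefK poly_def raddf_sum; apply: eq_bigr => k _ /=.
  by rewrite derivZ derivXn scaler_nat.
have XE : 'X * p = \sum_(k < size p) p`_k *: 'X^(k.+1).
  rewrite -[p in LHS]coefK poly_def mulr_sumr; apply: eq_bigr => k _ /=.
  by rewrite -scalerAr exprS.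
rewrite dE XE beta_sum mulr_sumr [(1 - 'X ^+ 2) * _]mulr_sumr beta_sum.
rewrite -big_split big1//= => k _.
rewrite -!scalerAr !betaZ betaXn [(1 - 'X ^+ 2) * _]mulrBl mul1r -exprD betaD betaN !betaXn.
case: k => -[|k] /= kp.
  by rewrite mul0r mulr0 addr0 /beta_weight /= !mulr0.
have kN : (k + 4 <= N)%N by apply: leq_trans pN; rewrite addn4 addn2 !ltnS.
have ww := beta_weightSS kN; rewrite add2n.
transitivity (p`_k.+1 * ((N%:R - k%:R - 3) * beta_weight N k.+2 +
  (k%:R + 1) * beta_weight N k)); first by rewrite -natr1; ring.
by rewrite ww; ring.
Qed.
End Pairings.

Definition incr (I : eqType) (a : I -> nat) k : I -> nat :=
  fun l => (a l + (l == k))%N.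
(** The subtraction is truncated; in the recursions [decr a k] comes with the factor [(a k)%:R],
    which disposes of the case [a k = 0]. *)
Definition decr (I : eqType) (a : I -> nat) k : I -> nat :=
  fun l => (a l - (l == k))%N.

Lemma decrK (I : eqType) (a : I -> nat) k : (0 < a k)%N ->
  incr (decr a k) k = a.
Proof.
move=> ak; apply/funext => l; rewrite /incr /decr.
by case: eqP => [->|_]; lia.
Qed.

Lemma sum_incr (I : finType) (a : I -> nat) k :
  (\sum_l incr a k l = (\sum_l a l).+1)%N.
Proof.
rewrite big_split/= -addn1; congr (_ + _)%N.
by rewrite (bigD1 k)//= eqxx big1// => l /negPf ->.
Qed.

Lemma sum_decr (I : finType) (a : I -> nat) k : (0 < a k)%N ->
  (\sum_l a l = (\sum_l decr a k l).+1)%N.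
Proof. by move=> ak; rewrite -{1}(decrK ak) sum_incr. Qed.

(** * The two-row recursion *)

Section TwoRowFormula.
Variables (R : numFieldType) (I : finType).
Implicit Types a b : I -> nat.

Definition pairings a b : {poly R} := \prod_k pairing R (a k) (b k).

Lemma pairings_size a b : (size (pairings a b) <= (\sum_k a k).+1)%N.
Proof.
apply: leq_trans (size_poly_prod_leq _ _) _.
have : (\sum_k size (pairing R (a k) (b k)) <= \sum_k (a k).+1)%N.
  by apply: leq_sum => k _; exact: pairing_size.
have -> : (\sum_k (a k).+1 = \sum_k a k + #|I|)%N.
  by under eq_bigr do rewrite -addn1; rewrite big_split /= sum1_card.
by rewrite leq_subLR addnS ltnS addnC.
Qed.

Lemma pairingsD1 a b j : pairings a b =
  pairing R (a j) (b j) * \prod_(k | k != j) pairing R (a k) (b k).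
Proof. by rewrite /pairings (bigD1 j). Qed.

Lemma pairings_at a b a' b' j : (forall k, k != j -> a k = a' k) ->
    (forall k, k != j -> b k = b' k) ->
  pairings a b =
  pairing R (a j) (b j) * \prod_(k | k != j) pairing R (a' k) (b' k).
Proof.
move=> aa bb; rewrite (pairingsD1 a b j); congr (_ * _).
by apply: eq_bigr => k kj; rewrite aa ?bb.
Qed.

Lemma incr_at a j k : k != j -> incr a j k = a k.
Proof. by rewrite /incr => /negPf ->; rewrite addn0. Qed.

Lemma decr_at a j k : k != j -> decr a j k = a k.
Proof. by rewrite /decr => /negPf ->; rewrite subn0. Qed.

Lemma pairings_opp a b :
  pairings a b \Po (- 'X) = (-1) ^+ (\sum_k a k) * pairings a b.
Proof.
rewrite /pairings (rmorph_prod (comp_poly (- 'X))) expr_sum -big_split/=.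
by apply: eq_bigr => k _; exact: pairing_opp.
Qed.

Lemma beta_pairings_odd N a b : odd (\sum_k a k) -> beta N (pairings a b) = 0.
Proof.
move=> oa; apply: beta_odd.
by rewrite pairings_opp -signr_odd oa mulN1r.
Qed.

Lemma deriv_pairings a b :
  \sum_k (a k)%:R * pairings (decr a k) (incr b k) =
  (1 - 'X ^+ 2) * (pairings a b)^`() + (\sum_k a k)%:R * 'X * pairings a b.
Proof.
rewrite deriv_prod mulr_sumr natr_sum !mulr_suml -big_split/=.
apply: eq_bigr => k _.
rewrite (@pairings_at _ _ a b k); try by move=> l lk; rewrite ?decr_at ?incr_at.
rewrite (pairingsD1 a b k) !mulrA -mulrDl.
by rewrite -pairing_shift /decr /incr eqxx subn1 addn1.
Qed.

(** In column j this is the elimination of [pairing a b.-1] between the two recursions [pairingS]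
    and [pairing_Sr]. *)
Lemma pairings_incr a b j :
  (a j)%:R * (1 - 'X ^+ 2) * pairings (decr a j) b - pairings (incr a j) b =
  - ('X * pairings a (incr b j)).
Proof.
rewrite (@pairings_at _ _ a b j); try by move=> l lj; rewrite ?decr_at ?incr_at.
rewrite (@pairings_at (incr a j) _ a b j); try by move=> l lj; rewrite ?decr_at ?incr_at.
rewrite (@pairings_at _ (incr b j) a b j); try by move=> l lj; rewrite ?decr_at ?incr_at.
rewrite !mulrA -mulrBl -[RHS]mulNr; congr (_ * _).
rewrite /decr /incr eqxx subn1 !addn1 pairingS pairing_Sr; ring.
Qed.

(** [beta_lower] and [pairings_incr] reduce everything to [beta N] of 'X times
    [pairings a (incr b j)]; integration by parts and [deriv_pairings] identify the remaining sum as
    a multiple of it. *)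
Lemma beta_recursion n a b j : (1 < n)%N ->
  let A := (\sum_k a k)%N in let B := (\sum_k b k)%N in
  let N := (A + B + n).+1 in
  (a j)%:R * (N%:R - 2) * beta (N - 2) (pairings (decr a j) b) =
  beta N (pairings (incr a j) b) + (B%:R + n%:R - 1)^-1 *
    \sum_k (a k)%:R * beta N (pairings (decr a k) (incr (incr b j) k)).
Proof.
move=> n1 A B N.
have D0 : B%:R + n%:R - 1 != 0 :> R.
  by rewrite -natrD -(@natrB _ _ 1) ?pnatr_eq0; lia.
have sN : (size (pairings a (incr b j)) + 2 <= N)%N.
  by have := pairings_size a (incr b j); rewrite -/A /N; lia.
have -> : (a j)%:R * (N%:R - 2) * beta (N - 2) (pairings (decr a j) b) =
    beta N ((a j)%:R * (1 - 'X ^+ 2) * pairings (decr a j) b).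
  have [->|aj] := posnP (a j); first by rewrite !mul0r beta0.
  have sN' : (size (pairings (decr a j) b) + 3 <= N)%N.
    have := pairings_size (decr a j) b; rewrite -(sum_decr aj) -/A /N.
    by have := sum_decr aj; rewrite -/A; lia.
  by rewrite -mulrA beta_lower// -beta_natl mulrA.
apply/eqP; rewrite [X in _ == X]addrC -subr_eq addrC -betaN -betaD.
have -> : - pairings (incr a j) b +
    (a j)%:R * (1 - 'X ^+ 2) * pairings (decr a j) b = - ('X * pairings a (incr b j)).
  by rewrite -(pairings_incr a b j) addrC.
under eq_bigr do rewrite -beta_natl.
rewrite -beta_sum deriv_pairings -/A betaD.
have -> : A%:R * 'X * pairings a (incr b j) = A%:R * ('X * pairings a (incr b j)).
  by rewrite mulrA.
rewrite beta_natl betaN; have := beta_by_parts sN.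
set x := beta _ _; set y := beta _ _ => /eqP.
rewrite addrC addr_eq0 => /eqP ->.
(* Of the N - 2 copies produced by parts, A cancel against the second term of [deriv_pairings]; the
   other B + n - 1 match the denominator. *)
have -> : (N%:R - 2) = A%:R + (B%:R + n%:R - 1) :> R.
  by rewrite /N -natr1 !natrD; ring.
by apply/eqP; field.
Qed.

Lemma pairings0_cst b : pairings (fun=> 0%N) b =
  (\prod_k (if odd (b k) then 0 else (dfact (b k))%:R))%:P.
Proof.
rewrite rmorph_prod; apply: eq_bigr => k _ /=; rewrite pairing0.
by case: ifP => _; rewrite ?polyC0// polyC_natr.
Qed.

Lemma pairings0_incr b j : (b j)%:R * pairings (fun=> 0%N) (decr b j) =
  pairings (fun=> 0%N) (incr b j).
Proof.
rewrite (@pairings_at _ _ (fun=> 0%N) b j); try by move=> l lj; rewrite ?decr_at.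
rewrite (@pairings_at _ (incr b j) (fun=> 0%N) b j); try by move=> l lj; rewrite ?incr_at.
by rewrite mulrA; congr (_ * _); rewrite /incr /decr eqxx addn1 subn1 pairing0S.
Qed.

Definition two_row_value n a b : R :=
  let A := (\sum_k a k)%N in let B := (\sum_k b k)%N in
  (dfact (n - 2) * dfact (n - 1))%:R * beta (A + B + n) (pairings a b) /
  (dfact (A + n - 2) * dfact (B + n - 2) * dfact (A + B + n - 1))%:R.

(** This is [beta_recursion] after clearing the double factorials; A > 0 keeps A + n - 3 from being
    truncated. *)
Lemma two_row_value_rec n a b j : (1 < n)%N -> (0 < \sum_k a k)%N ->
  (a j)%:R * two_row_value n (decr a j) b =
  ((\sum_k a k)%:R + n%:R - 2) * two_row_value n (incr a j) b +
  \sum_k (a k)%:R * two_row_value n (decr a k) (incr (incr b j) k).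
Proof.
move=> n1; rewrite /two_row_value; set c := (_ * _)%:R.
have := @beta_recursion n a b j n1 => /=; rewrite !sum_incr.
set A := (\sum_k a k)%N; set B := (\sum_k b k)%N => rec A0.
(* [x], [y] and [z] are the denominators on the left side; those of the other terms differ from them
   by the linear factors in [E1], [E2] and [E3]. *)
pose x : R := (dfact (A + n - 3))%:R; pose y : R := (dfact (B + n - 2))%:R.
pose z : R := (dfact (A + B + n - 2))%:R.
have neq0 m : (dfact m)%:R != 0 :> R by rewrite pnatr_eq0 -lt0n dfact_gt0.
have E1 : (dfact (A.+1 + n - 2))%:R = (A%:R + n%:R - 2) * x.
  have -> : (A.+1 + n - 2 = (A + n - 3).+2)%N by lia.
  rewrite dfactSS natrM; congr (_ * _).
  by rewrite -natrD -(@natrB _ _ 2)//; [congr _%:R; lia|lia].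
have E2 : (dfact (A.+1 + B + n - 1))%:R = (A%:R + B%:R + n%:R - 1) * z.
  have -> : (A.+1 + B + n - 1 = (A + B + n - 2).+2)%N by lia.
  rewrite dfactSS natrM; congr (_ * _).
  by rewrite -!natrD -(@natrB _ _ 1)//; [congr _%:R; lia|lia].
have E3 : (dfact (B.+2 + n - 2))%:R = (B%:R + n%:R - 1) * y.
  have -> : (B.+2 + n - 2 = (B + n - 2).+2)%N by lia.
  rewrite dfactSS natrM; congr (_ * _).
  by rewrite -natrD -(@natrB _ _ 1)//; [congr _%:R; lia|lia].
have -> : \sum_k (a k)%:R * (c *
      beta (\sum_l decr a k l + (\sum_l incr (incr b j) k l) + n)
        (pairings (decr a k) (incr (incr b j) k)) /
      (dfact (\sum_l decr a k l + n - 2) *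
       dfact (\sum_l incr (incr b j) k l + n - 2) *
       dfact (\sum_l decr a k l + (\sum_l incr (incr b j) k l) + n - 1))%:R) =
    c / (x * ((B%:R + n%:R - 1) * y) * ((A%:R + B%:R + n%:R - 1) * z)) *
    \sum_k (a k)%:R * beta (A + B + n).+1 (pairings (decr a k) (incr (incr b j) k)).
  rewrite mulr_sumr; apply: eq_bigr => k _.
  have [->|ak] := posnP (a k); first by rewrite !mul0r mulr0.
  rewrite !sum_incr -/B; have := sum_decr ak; rewrite -/A => AE.
  set D := (\sum_l decr a k l)%N in AE *.
  rewrite !natrM E3 -E2 /x AE.
  have -> : (D + B.+2 + n = (D.+1 + B + n).+1)%N by lia.
  have -> : (D + n - 2 = D.+1 + n - 3)%N by lia.
  have -> : ((D.+1 + B + n).+1 - 1 = D.+2 + B + n - 1)%N by lia.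
  ring.
have -> : (a j)%:R * (c * beta (\sum_l decr a j l + B + n) (pairings (decr a j) b) /
      (dfact (\sum_l decr a j l + n - 2) * dfact (B + n - 2) *
       dfact (\sum_l decr a j l + B + n - 1))%:R) =
    c / (x * y * z) * ((a j)%:R * beta ((A + B + n).+1 - 2) (pairings (decr a j) b)).
  have [->|aj] := posnP (a j); first by rewrite !mul0r mulr0.
  have := sum_decr aj; rewrite -/A => AE.
  set D := (\sum_l decr a j l)%N in AE *.
  rewrite !natrM /x /y /z AE.
  have -> : ((D.+1 + B + n).+1 - 2 = D + B + n)%N by lia.
  have -> : (D + n - 2 = D.+1 + n - 3)%N by lia.
  have -> : (D + B + n - 1 = D.+1 + B + n - 2)%N by lia.
  ring.
rewrite !natrM E1 E2 -/y.
have p1 : A%:R + n%:R - 2 != 0 :> R.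
  by rewrite -natrD -(@natrB _ _ 2) ?pnatr_eq0; lia.
have p2 : A%:R + B%:R + n%:R - 1 != 0 :> R.
  by rewrite -!natrD -(@natrB _ _ 1) ?pnatr_eq0; lia.
have p3 : B%:R + n%:R - 1 != 0 :> R.
  by rewrite -natrD -(@natrB _ _ 1) ?pnatr_eq0; lia.
have NE : (A + B + n).+1%:R - 2 = A%:R + B%:R + n%:R - 1 :> R.
  by rewrite -natr1 !natrD; ring.
have -> : (A.+1 + B + n = (A + B + n).+1)%N by lia.
move: rec; rewrite NE -mulrA (mulrCA _ (_ - 1)).
set t := (a j)%:R * _ => rec.
have -> : t = (A%:R + B%:R + n%:R - 1)^-1 * (beta (A + B + n).+1 (pairings (incr a j) b) +
   (B%:R + n%:R - 1)^-1 * \sum_k (a k)%:R *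
     beta (A + B + n).+1 (pairings (decr a k) (incr (incr b j) k))).
  by rewrite -rec mulKf.
have x0 : x != 0 := neq0 _; have y0 : y != 0 := neq0 _; have z0 : z != 0 := neq0 _.
field; do ! (apply/andP; split => //).
Qed.

Lemma sum0_nat : (\sum_(k : I) 0)%N = 0%N.
Proof. exact: big1_eq. Qed.

(** With an empty first row the pairing polynomial is constant, so only [betaC] is involved: this is
    the moment recursion on a sphere. *)
Lemma two_row_value0_rec n b j : (1 < n)%N ->
  (b j)%:R * two_row_value n (fun=> 0%N) (decr b j) =
  ((\sum_k b k)%:R + n%:R - 1) * two_row_value n (fun=> 0%N) (incr b j).
Proof.
move=> n1; rewrite /two_row_value; set c := (_ * _)%:R.
have neq0 m : (dfact m)%:R != 0 :> R by rewrite pnatr_eq0 -lt0n dfact_gt0.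
rewrite !sum0_nat !add0n -pairings0_incr sum_incr beta_natl.
have [->|bj] := posnP (b j); first by rewrite !(mul0r, mulr0).
have := sum_decr bj => BE; set D := (\sum_l decr b j l)%N in BE *.
rewrite BE pairings0_cst !betaC.
rewrite !natrM.
have -> : (D.+2 + n - 1 = (D.+1 + n - 2).+2)%N by lia.
have -> : (D + n - 1 = D.+1 + n - 2)%N by lia.
rewrite dfactSS natrM.
have -> : (D.+1 + n - 2).+1%:R = D.+1%:R + n%:R - 1 :> R.
  by rewrite -natrD -(@natrB _ _ 1)//; congr _%:R; lia.
have d0 : D.+1%:R + n%:R - 1 != 0 :> R.
  by rewrite -natrD -(@natrB _ _ 1) ?pnatr_eq0; lia.
have [d1 d2 d3 d4] := And4 (neq0 (D + n - 2)%N) (neq0 (n - 2)%N)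
  (neq0 (D.+1 + n - 2)%N) (neq0 (D.+2 + n - 2)%N).
by field; rewrite d1 d2 d3 d4 !andbT /= nat1r.
Qed.

Lemma two_row_value_odd n a b : odd (\sum_k a k) -> two_row_value n a b = 0.
Proof.
by move=> oa; rewrite /two_row_value beta_pairings_odd// mulr0 mul0r.
Qed.

Lemma two_row_value_0 n : two_row_value n (fun=> 0%N) (fun=> 0%N) = 1.
Proof.
rewrite /two_row_value !sum0_nat !add0n pairings0_cst big1 ?betaC => [|k _]; last first.
  by rewrite /= dfact0.
rewrite mul1r -natrM (mulnAC _ (dfact (n - 1))) divff// pnatr_eq0 -lt0n.
by rewrite !muln_gt0 !dfact_gt0.
Qed.

(** Induction on the total degree and, within it, on the degree A of the first row. Solving the
    recursion at [decr a j] for [M a b] leaves terms of smaller total degree and terms that move two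
    units from the first row to the second. *)
Lemma two_row_value_unique n (M : (I -> nat) -> (I -> nat) -> R) : (1 < n)%N ->
    M (fun=> 0%N) (fun=> 0%N) = 1 ->
    (forall a b, odd (\sum_k a k) -> M a b = 0) ->
    (forall b j, (b j)%:R * M (fun=> 0%N) (decr b j) =
      ((\sum_k b k)%:R + n%:R - 1) * M (fun=> 0%N) (incr b j)) ->
    (forall a b j, (a j)%:R * M (decr a j) b =
      ((\sum_k a k)%:R + n%:R - 2) * M (incr a j) b +
      \sum_k (a k)%:R * M (decr a k) (incr (incr b j) k)) ->
  forall a b, M a b = two_row_value n a b.
Proof.
move=> n1 M0 Modd Mpure Mrec a b.
have [m] := ubnP (\sum_k a k + \sum_k b k)%N.
elim: m => // m IHm in a b *; have [l] := ubnP (\sum_k a k)%N.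
elim: l => // l IHl in a b *; rewrite !ltnS => al abm.
have [oa|ea] := boolP (odd (\sum_k a k)); first by rewrite Modd// two_row_value_odd.
have [j aj|a0] := pickP (fun j => 0 < a j)%N.
  have := Mrec (decr a j) b j; have := @two_row_value_rec n (decr a j) b j n1.
  rewrite !decrK//; have := sum_decr aj; set A0 := (\sum_k decr a j k)%N => AE.
  (* A is even and positive, so A - 1 > 0; this makes the coefficient to divide by nonzero even for
     n = 2. *)
  have A0_gt0 : (0 < A0)%N by case: A0 AE => // AE; rewrite AE in ea.
  move=> /(_ A0_gt0) rec1 rec2.
  have p1 : A0%:R + n%:R - 2 != 0 :> R.
    by rewrite -natrD -(@natrB _ _ 2) ?pnatr_eq0; lia.
  apply: (mulfI p1).
  have E1 : (decr a j j)%:R * M (decr (decr a j) j) b =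
      (decr a j j)%:R * two_row_value n (decr (decr a j) j) b.
    have [->|d] := posnP (decr a j j); first by rewrite !mul0r.
    by rewrite IHm//; have := sum_decr d; rewrite -/A0; lia.
  have E2 : \sum_k (decr a j k)%:R * M (decr (decr a j) k) (incr (incr b j) k) =
      \sum_k (decr a j k)%:R *
        two_row_value n (decr (decr a j) k) (incr (incr b j) k).
    apply: eq_bigr => k _.
    have [->|d] := posnP (decr a j k); first by rewrite !mul0r.
    have := sum_decr d; rewrite -/A0 => A0E.
    by rewrite IHl// ?sum_incr; lia.
  by apply: (addIr (\sum_k (decr a j k)%:R * M (decr (decr a j) k) (incr (incr b j) k)));
    rewrite -rec2 E1 rec1 E2.
have {a0} aE : a = fun=> 0%N.
  by apply/funext => k; have := a0 k; case: (a k).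
have [j bj|b0] := pickP (fun j => 0 < b j)%N; last first.
  have -> : b = fun=> 0%N by apply/funext => k; have := b0 k; case: (b k).
  by rewrite aE M0 two_row_value_0.
have := Mpure (decr b j) j; have := @two_row_value0_rec n (decr b j) j n1.
rewrite !decrK//; have := sum_decr bj; set B0 := (\sum_k decr b j k)%N => BE.
have p1 : B0%:R + n%:R - 1 != 0 :> R.
  by rewrite -natrD -(@natrB _ _ 1) ?pnatr_eq0; lia.
rewrite aE => rec1 rec2; apply: (mulfI p1); rewrite -rec1 -rec2.
have [->|d] := posnP (decr b j j); first by rewrite !mul0r.
rewrite IHm// sum0_nat add0n; have := sum_decr d; rewrite -/B0; lia.
Qed.

End TwoRowFormula.

(** * Signed products of double factorials *)

Section WeightedProduct.
Variable R : numFieldType.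
Implicit Types (f : nat -> R) (P Q : {poly int}).

(* A multiset of naturals is encoded by the polynomial [\sum_m 'X^m], so that
   signed unions become sums and products over them become [wprod]. *)
Definition wprod f P : R := \prod_(m < size P) f m ^ P`_m.

Lemma wprod_wide f P k : (size P <= k)%N ->
  wprod f P = \prod_(m < k) f m ^ P`_m.
Proof.
move=> Pk; rewrite /wprod (big_ord_widen k (fun m => f m ^ P`_m))//.
rewrite big_mkcond; apply: eq_bigr => m _; case: ltnP => // sm.
by rewrite nth_default ?expr0z.
Qed.

Lemma wprodD f P Q : (forall m, f m != 0) ->
  wprod f (P + Q) = wprod f P * wprod f Q.
Proof.
move=> f0; pose k := maxn (size P) (size Q).
rewrite (@wprod_wide _ (P + Q) k) ?size_polyD//.
rewrite (@wprod_wide _ P k) ?leq_maxl// (@wprod_wide _ Q k) ?leq_maxr//.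
by rewrite -big_split; apply: eq_bigr => m _; rewrite coefD expfzDr.
Qed.

Lemma wprodN f P : wprod f (- P) = (wprod f P)^-1.
Proof.
rewrite /wprod size_polyN -prodfV; apply: eq_bigr => m _.
by rewrite coefN invr_expz.
Qed.

Lemma wprod0 f : wprod f 0 = 1.
Proof. by rewrite /wprod size_poly0 big_ord0. Qed.

Lemma wprod_sum f I (r : seq I) (F : I -> {poly int}) : (forall m, f m != 0) ->
  wprod f (\sum_(i <- r) F i) = \prod_(i <- r) wprod f (F i).
Proof.
by move=> f0; apply: (big_morph _ (fun P Q => wprodD P Q f0) (wprod0 f)).
Qed.

Lemma wprodXn f k : wprod f 'X^k = f k.
Proof.
rewrite /wprod size_polyXn big_ord_recr/= coefXn eqxx expr1z big1 ?mul1r// => i _.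
by rewrite coefXn ltn_eqF ?expr0z.
Qed.

Lemma wprodMXn f P c : wprod f ('X^c * P) = wprod (fun m => f (c + m)%N) P.
Proof.
rewrite (@wprod_wide _ _ (c + size P)); last first.
  by apply: leq_trans (size_polyMleq _ _) _; rewrite size_polyXn; lia.
rewrite big_split_ord/= big1 ?mul1r => [|i _]; last first.
  by rewrite coefXnM ltn_ord expr0z.
apply: eq_bigr => i _; rewrite coefXnM.
by rewrite ltnNge leq_addr/= addKn.
Qed.

Lemma wprod_neq0 f P : (forall m, f m != 0) -> wprod f P != 0.
Proof. by move=> f0; apply/prodf_neq0 => m _; rewrite expfz_neq0. Qed.

Definition dfact_shift n m : R := (dfact (m + n - 2))%:R.

Lemma dfact_shift_neq0 n m : dfact_shift n m != 0.
Proof. by rewrite pnatr_eq0 -lt0n dfact_gt0. Qed.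

Lemma bracket_wprod n M :
  (bracket n M)%:R = wprod (dfact_shift n) (\sum_(m <- M) 'X^m).
Proof.
rewrite wprod_sum; last exact: dfact_shift_neq0.
by rewrite natr_prod; apply: eq_bigr => m _; rewrite wprodXn.
Qed.

Definition column_poly q (x : 'M[nat]_(2, q)) t : {poly int} :=
  'X^(x ord0 t) + 'X^(x ord_max t).

(** Choosing one row for each column of T amounts to expanding the product over T of the two-term
    column polynomials. *)
Lemma P_multiset_poly q (x : 'M[nat]_(2, q)) r :
  \sum_(m <- P_multiset x r) 'X^m =
  \sum_(T : {set 'I_q} | #|T| == r) \prod_(t in T) column_poly x t.
Proof.
rewrite /P_multiset big_flatten big_map big_enum /=.
under eq_bigl do rewrite inE.
apply: eq_bigr => T _; rewrite big_image /=.
have colE t : column_poly x t = \sum_(i < 2) 'X^(x i t).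
  rewrite big_ord_recl big_ord1 /column_poly; congr (_ + 'X^(x _ _)).
  exact: val_inj.
transitivity (\prod_(t : {t : 'I_q | t \in T}) \sum_(i : 'I_2)
    ('X^(x i (val t)) : {poly int})).
  by rewrite bigA_distr_bigA; apply: eq_big => // i _; rewrite expr_sum.
by rewrite [RHS]big_sub; apply: eq_bigr => t _; rewrite colE.
Qed.

(** Expand the product on the right according to the set T of columns that contribute [column_poly]:
    the others give the sign (-1)^(q - |T|). Then group by |T|. *)
Lemma alternating_P_multiset q (x : 'M[nat]_(2, q)) :
  \sum_(0 <= r < q.+1 | ~~ odd (q - r)) \sum_(m <- P_multiset x r) 'X^m -
  \sum_(0 <= r < q.+1 | odd (q - r)) \sum_(m <- P_multiset x r) 'X^m =
  \prod_t (column_poly x t - 1).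
Proof.
transitivity (\sum_(0 <= r < q.+1) \sum_(T : {set 'I_q} | #|T| == r)
    (-1) ^+ (q - #|T|) * \prod_(t in T) column_poly x t).
  rewrite [RHS](bigID (fun r => odd (q - r))) /= addrC -sumrN; congr (_ + _).
    apply: eq_bigr => r /negPf or; rewrite P_multiset_poly.
    apply: eq_bigr => T /eqP ->; rewrite -signr_odd or mul1r//.
  apply: eq_bigr => r or; rewrite P_multiset_poly -sumrN.
  by apply: eq_bigr => T /eqP ->; rewrite -signr_odd or mulN1r.
rewrite big_mkord bigA_distr /=.
rewrite (partition_big (fun T : {set 'I_q} => inord #|T| : 'I_q.+1) xpredT) //=.
apply: eq_bigr => r _; apply: eq_big => [T|T /eqP Tr].
  rewrite -val_eqE /= inordK// ltnS.
  by rewrite (leq_trans (max_card _))// card_ord.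
have -> : (q - #|T|)%N = #|~: T| by rewrite [in RHS]cardsCs finset.setCK card_ord.
rewrite -[#|~: T|]sum1_card expr_sum mulrC.
rewrite [RHS](bigID (mem T)) /=; congr (_ * _).
  by apply: eq_bigr => t ->.
by apply: eq_big => [t|t]; rewrite inE// => /negPf ->.
Qed.

Lemma Gamma_ratio n q (x : 'M[nat]_(2, q)) :
  (\prod_(0 <= r < q.+1 | ~~ odd (q - r)) bracket n (P_multiset x r))%:R =
  wprod (dfact_shift n) (\prod_t (column_poly x t - 1)) *
  (\prod_(0 <= r < q.+1 | odd (q - r)) bracket n (P_multiset x r))%:R.
Proof.
have f0 := dfact_shift_neq0 n.
have E (p : pred nat) :
    (\prod_(0 <= r < q.+1 | p r) bracket n (P_multiset x r))%:R =
    wprod (dfact_shift n)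
      (\sum_(0 <= r < q.+1 | p r) \sum_(m <- P_multiset x r) 'X^m).
  rewrite -!(big_filter _ p) wprod_sum// natr_prod.
  by apply: eq_bigr => r _; exact: bracket_wprod.
by rewrite !E -alternating_P_multiset wprodD// wprodN mulfVK// wprod_neq0.
Qed.

End WeightedProduct.

(** * Haar means of polynomial functions *)

Section PolynomialFunctions.
Variables (R : realType) (n : nat).
Implicit Types f g : 'M[R]_n -> R.

(** Generating these functions inductively lets continuity, boundedness on the orthogonal group and
    hence integrability be proved by induction. *)
Inductive polyfun : ('M[R]_n -> R) -> Prop :=
| polyfun_cst c : polyfun (fun=> c)
| polyfun_coord i j : polyfun (fun u => u i j)
| polyfun_add f g : polyfun f -> polyfun g -> polyfun (fun u => f u + g u)
| polyfun_mul f g : polyfun f -> polyfun g -> polyfun (fun u => f u * g u).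

Lemma polyfun_sum I (r : seq I) (F : I -> 'M[R]_n -> R) :
  (forall i, polyfun (F i)) -> polyfun (fun u => \sum_(i <- r) F i u).
Proof.
move=> pF; elim: r => [|i r IH].
  by under eq_fun do rewrite big_nil; exact: polyfun_cst.
by under eq_fun do rewrite big_cons; exact: polyfun_add.
Qed.

Lemma polyfun_prod I (r : seq I) (F : I -> 'M[R]_n -> R) :
  (forall i, polyfun (F i)) -> polyfun (fun u => \prod_(i <- r) F i u).
Proof.
move=> pF; elim: r => [|i r IH].
  by under eq_fun do rewrite big_nil; exact: polyfun_cst.
by under eq_fun do rewrite big_cons; exact: polyfun_mul.
Qed.

Lemma polyfun_exp f k : polyfun f -> polyfun (fun u => f u ^+ k).
Proof.
move=> pf; elim: k => [|k IH].
  by under eq_fun do rewrite expr0; exact: polyfun_cst.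
by under eq_fun do rewrite exprS; exact: polyfun_mul.
Qed.

Lemma polyfun_comp f (h : 'M[R]_n -> 'M[R]_n) :
  (forall i j, polyfun (fun u => h u i j)) -> polyfun f ->
  polyfun (f \o h).
Proof.
move=> ph; elim=> {f} [c|i j|f g _ pf _ pg|f g _ pf _ pg].
- exact: polyfun_cst.
- exact: ph.
- exact: polyfun_add.
- exact: polyfun_mul.
Qed.

Lemma measurable_open_preimage (h : 'M[R]_n -> R) :
  continuous h -> measurable_fun [set: borel_mx R n] (h : borel_mx R n -> R).
Proof.
move=> ch; apply: (measurability _ (RGenOpens.measurableE R)).
move=> _ [_ [a [b ->] <-]]; rewrite setTI; apply: sub_sigma_algebra.
by move/continuousP : ch; apply; exact: interval_open.
Qed.

Lemma continuous_polyfun f : polyfun f -> continuous f.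
Proof.
elim=> {f} [c|i j|f g _ cf _ cg|f g _ cf _ cg].
- exact: cst_continuous.
- exact: coord_continuous.
- by move=> u; apply: continuousD; [exact: cf|exact: cg].
- by move=> u; apply: continuousM; [exact: cf|exact: cg].
Qed.

Lemma polyfun_mulmx (g : 'M[R]_n) i j : polyfun (fun u => (g *m u) i j).
Proof.
under eq_fun do rewrite mxE.
by apply: polyfun_sum => k; apply: polyfun_mul;
  [exact: polyfun_cst|exact: polyfun_coord].
Qed.

Lemma continuous_mulmx (g : 'M[R]_n) :
  continuous (fun u : 'M[R]_n => g *m u).
Proof.
move=> u B [P nP PB].
(* Neighbourhoods of a matrix are entrywise, and there are finitely many entries. *)
have : \forall v \near u, forall ij : 'I_n * 'I_n, P ij.1 ij.2 ((g *m v) ij.1 ij.2).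
  apply: (@filter_forall _ _ (fun ij v => P ij.1 ij.2 ((g *m v) ij.1 ij.2))
    (nbhs u)) => -[i j] /=.
  exact: (continuous_polyfun (polyfun_mulmx g i j) (nP i j)).
by apply: filterS => v Pv; apply: PB => i j; exact: Pv (i, j).
Qed.

Lemma measurable_mulmx (g : 'M[R]_n) :
  measurable_fun [set: borel_mx R n]
    ((fun u : 'M[R]_n => g *m u) : borel_mx R n -> borel_mx R n).
Proof.
apply: (@measurability _ _ (borel_mx R n) (borel_mx R n) _ _ (@open 'M[R]_n)) => //.
move=> _ [B oB <-]; rewrite setTI; apply: sub_sigma_algebra.
by move/continuousP : (@continuous_mulmx g); apply.
Qed.

Lemma measurable_polyfun f (D : set (borel_mx R n)) :
  polyfun f -> measurable_fun D (f : borel_mx R n -> R).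
Proof.
move=> pf; apply: measurable_funTS.
exact: measurable_open_preimage (continuous_polyfun pf).
Qed.

Lemma measurable_orthogonal_group : measurable (orthogonal_group R n).
Proof.
have -> : orthogonal_group R n =
    \bigcap_(i in [set: 'I_n]) \bigcap_(j in [set: 'I_n])
      ((fun u : 'M[R]_n => (u *m u^T) i j) @^-1` [set (1%:M : 'M[R]_n) i j]).
  apply/seteqP; split=> [u /= uu i _ j _ /=|u /= H]; first by rewrite uu.
  by apply/matrixP => i j; exact: H.
apply: fin_bigcap_measurable => // i _; apply: fin_bigcap_measurable => // j _.
rewrite -[X in measurable X]setTI.
have : measurable_fun [set: borel_mx R n]
   ((fun u : 'M[R]_n => (u *m u^T) i j) : borel_mx R n -> R).
  apply: measurable_polyfun.
  under eq_fun do rewrite mxE.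
  apply: polyfun_sum => k; apply: polyfun_mul; first exact: polyfun_coord.
  by under eq_fun do rewrite mxE; exact: polyfun_coord.
by apply=> //; exact: measurable_set1.
Qed.

Lemma orthogonal_entry_le1 (u : 'M[R]_n) i j :
  orthogonal_group R n u -> `|u i j| <= 1.
Proof.
move=> uu; rewrite -(@expr_le1 _ 2)// real_normK ?num_real//.
have /matrixP/(_ i i) := uu; rewrite !mxE eqxx /= mulr1n => <-.
rewrite (bigD1 j)//= mxE -expr2 lerDl sumr_ge0// => k _.
by rewrite mxE -expr2 sqr_ge0.
Qed.

Lemma polyfun_bounded f : polyfun f ->
  exists M : R, forall u, orthogonal_group R n u -> `|f u| <= M.
Proof.
elim=> {f} [c|i j|f g _ [M fM] _ [N gN]|f g _ [M fM] _ [N gN]].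
- by exists `|c|.
- by exists 1 => u uu; exact: orthogonal_entry_le1.
- exists (M + N) => u uu.
  by rewrite (le_trans (ler_normD _ _))// lerD// ?fM ?gN.
- exists (M * N) => u uu; rewrite normrM ler_pM// ?fM ?gN//.
Qed.

Variable mu : probability (borel_mx R n) R.

Lemma polyfun_integrable f : polyfun f ->
  mu.-integrable (orthogonal_group R n) (EFin \o (f : borel_mx R n -> R)).
Proof.
move=> pf; have [M fM] := polyfun_bounded pf.
have mO := measurable_orthogonal_group.
apply: (@le_integrable _ _ _ mu _ mO _ (EFin \o cst M)).
- by apply/measurable_EFinP; exact: measurable_polyfun.
- by move=> u uu /=; rewrite lee_fin (le_trans (fM _ uu))// ler_norm.
- exact: finite_measure_integrable_cst.
Qed.


Hypothesis mu_haar : is_haar mu.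

Definition haar_mean (f : 'M[R]_n -> R) : R :=
  \int[mu]_(u in orthogonal_group R n) f u.

Lemma eq_haar_mean f g :
  (forall u, orthogonal_group R n u -> f u = g u) -> haar_mean f = haar_mean g.
Proof. by move=> fg; apply: eq_Rintegral => u /set_mem; exact: fg. Qed.

Lemma haar_mean_cst c : haar_mean (fun=> c) = c.
Proof.
rewrite /haar_mean Rintegral_cst; last exact: measurable_orthogonal_group.
have [m1 _] := mu_haar; transitivity (c * fine 1%E); last exact: mulr1.
by congr (_ * fine _); exact: m1.
Qed.

Lemma haar_meanD f g : polyfun f -> polyfun g ->
  haar_mean (fun u => f u + g u) = haar_mean f + haar_mean g.
Proof.
by move=> pf pg; rewrite /haar_mean RintegralD//;
  [exact: measurable_orthogonal_group|exact: polyfun_integrable..].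
Qed.

Lemma haar_meanZ c f : polyfun f ->
  haar_mean (fun u => c * f u) = c * haar_mean f.
Proof.
by move=> pf; rewrite /haar_mean RintegralZl//;
  [exact: measurable_orthogonal_group|exact: polyfun_integrable].
Qed.

Lemma haar_mean_sum I (r : seq I) (F : I -> 'M[R]_n -> R) :
  (forall i, polyfun (F i)) ->
  haar_mean (fun u => \sum_(i <- r) F i u) = \sum_(i <- r) haar_mean (F i).
Proof.
move=> pF; elim: r => [|i r IH].
  by rewrite big_nil; under eq_fun do rewrite big_nil; rewrite haar_mean_cst.
under eq_fun do rewrite big_cons.
by rewrite big_cons haar_meanD ?IH//; exact: polyfun_sum.
Qed.

Lemma orthogonal_mulmx (g u : 'M[R]_n) : orthogonal_group R n g ->
  orthogonal_group R n (g *m u) <-> orthogonal_group R n u.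
Proof.
move=> gg; rewrite /orthogonal_group /= trmx_mul mulmxA -(mulmxA g u).
have g'g := mulmx1C gg.
split=> [|->]; last by rewrite mulmx1.
move=> /(congr1 (fun m => g^T *m m *m g)); rewrite mulmx1 g'g.
by rewrite !mulmxA g'g mul1mx -mulmxA g'g mulmx1.
Qed.

Lemma orthogonal_trmx (u : 'M[R]_n) :
  orthogonal_group R n u -> orthogonal_group R n u^T.
Proof. by move=> /mulmx1C; rewrite /orthogonal_group /= trmxK. Qed.

(** Change of variables: the pushforward of [mu] under left multiplication by g agrees with [mu] on
    measurable sets, and g preserves the orthogonal group. *)
Lemma haar_mean_mulmx (g : 'M[R]_n) f : orthogonal_group R n g -> polyfun f ->
  haar_mean (fun u => f (g *m u)) = haar_mean f.
Proof.
move=> og pf; rewrite /haar_mean /Rintegral.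
have mO := measurable_orthogonal_group.
have mg := measurable_mulmx g.
pose gm : borel_mx R n -> borel_mx R n := fun u : 'M[R]_n => g *m u.
have gO : gm @^-1` orthogonal_group R n = orthogonal_group R n.
  by apply/seteqP; split=> u /=; rewrite orthogonal_mulmx.
have pfg : polyfun (fun u => f (g *m u)).
  by apply: (polyfun_comp _ pf) => i j; exact: polyfun_mulmx.
have := @integral_pushforward _ _ (borel_mx R n) (borel_mx R n) R gm mg mu
  (orthogonal_group R n) (EFin \o f).
rewrite gO => <- //; last 2 first.
- by apply/measurable_EFinP; exact: measurable_polyfun.
- exact: (polyfun_integrable pfg).
congr fine; apply: eq_measure_integral => A mA _.
by have [_ invmu] := mu_haar; exact: invmu.
Qed.

(** Finite sums of products f(u) g(v). For these, exchanging the two means follows from linearity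
    alone, with no product measure. *)
Inductive separable : ('M[R]_n -> 'M[R]_n -> R) -> Prop :=
| separable_mul f g : polyfun f -> polyfun g ->
    separable (fun u v => f u * g v)
| separable_add F G : separable F -> separable G ->
    separable (fun u v => F u v + G u v).

Lemma separableM F G : separable F -> separable G ->
  separable (fun u v => F u v * G u v).
Proof.
move=> + sG; elim=> {F} [f g pf pg|F F' _ IH _ IH'].
  elim: sG => {G} [h k ph pk|G G' _ IH _ IH'].
    under eq_fun do under eq_fun do rewrite mulrACA.
    by apply: separable_mul; exact: polyfun_mul.
  under eq_fun do under eq_fun do rewrite mulrDr.
  exact: separable_add.
under eq_fun do under eq_fun do rewrite mulrDl.
exact: separable_add.
Qed.

Lemma separable_polyfun F : separable F ->
  (forall v, polyfun (fun u => F u v)) /\ (forall u, polyfun (F u)).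
Proof.
elim=> {F} [f g pf pg|F G _ [pF pF'] _ [pG pG']].
  by split=> v; apply: polyfun_mul => //; exact: polyfun_cst.
by split=> v; apply: polyfun_add.
Qed.

Lemma separable_Fubini F : separable F ->
  [/\ polyfun (fun u => haar_mean (F u)),
      polyfun (fun v => haar_mean (F^~ v)) &
      haar_mean (fun u => haar_mean (F u)) =
      haar_mean (fun v => haar_mean (F^~ v))].
Proof.
elim=> {F} [f g pf pg|F G sF [pF pF' IHF] sG [pG pG' IHG]].
  have -> : (fun u => haar_mean (fun v => f u * g v)) =
      (fun u => haar_mean g * f u).
    by apply/funext => u; rewrite haar_meanZ// mulrC.
  have -> : (fun v => haar_mean (fun u => f u * g v)) =
      (fun v => haar_mean f * g v).
    apply/funext => v; under eq_fun do rewrite mulrC.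
    by rewrite haar_meanZ// mulrC.
  rewrite !haar_meanZ// mulrC; split=> //;
    by apply: polyfun_mul => //; exact: polyfun_cst.
have [F1 F2] := separable_polyfun sF; have [G1 G2] := separable_polyfun sG.
have -> : (fun u => haar_mean (fun v => F u v + G u v)) =
    (fun u => haar_mean (F u) + haar_mean (G u)).
  by apply/funext => u; rewrite haar_meanD.
have -> : (fun v => haar_mean (fun u => F u v + G u v)) =
    (fun v => haar_mean (F^~ v) + haar_mean (G^~ v)).
  by apply/funext => v; rewrite haar_meanD.
by split; [exact: polyfun_add..|rewrite !haar_meanD// IHF IHG].
Qed.

Lemma separable_trmul f : polyfun f -> separable (fun u v => f (u^T *m v)).
Proof.
have scst c : separable (fun _ _ => c).
  rewrite (_ : (fun _ _ => c) = (fun (_ _ : 'M[R]_n) => c * 1)).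
    by apply: (@separable_mul (fun=> c) (fun=> 1)); exact: polyfun_cst.
  by apply/funext => u; apply/funext => v; rewrite mulr1.
elim=> {f} [c|i j|f g _ sf _ sg|f g _ sf _ sg] //.
- under eq_fun do under eq_fun do rewrite mxE.
  elim: (index_enum _) => [|k r IH].
    by under eq_fun do under eq_fun do rewrite big_nil.
  under eq_fun do under eq_fun do rewrite big_cons.
  apply: separable_add => //.
  under eq_fun do under eq_fun do rewrite mxE.
  by apply: (@separable_mul (fun u => u k i) (fun u => u k j));
    exact: polyfun_coord.
- exact: separable_add.
- exact: separableM.
Qed.

(* Averaging [f (u^T v)] over v gives the mean of f, averaging it over u gives
   the mean of f o trmx: only left invariance is used. *)
Lemma haar_mean_trmx f : polyfun f -> haar_mean (fun u => f u^T) = haar_mean f.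
Proof.
move=> pf; have [_ _ Fub] := separable_Fubini (separable_trmul pf).
have pfT : polyfun (fun u => f u^T).
  apply: (polyfun_comp _ pf) => i j.
  by under eq_fun do rewrite mxE; exact: polyfun_coord.
have E1 : haar_mean (fun u => haar_mean (fun v => f (u^T *m v))) = haar_mean f.
  rewrite (@eq_haar_mean _ (fun=> haar_mean f)) ?haar_mean_cst// => u ou.
  by rewrite haar_mean_mulmx//; exact: orthogonal_trmx.
have E2 : haar_mean (fun v => haar_mean (fun u => f (u^T *m v))) =
    haar_mean (fun u => f u^T).
  rewrite (@eq_haar_mean _ (fun=> haar_mean (fun u => f u^T))) ?haar_mean_cst//.
  move=> v ov; rewrite -(@haar_mean_mulmx v^T (fun u => f u^T))//; last exact: orthogonal_trmx.
  by apply: eq_haar_mean => u _; rewrite trmx_mul trmxK.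
by rewrite -E2 -Fub E1.
Qed.

(** * Monomials and infinitesimal rotations of two rows *)

Definition monom (e : 'I_n * 'I_n -> nat) (u : 'M[R]_n) : R :=
  \prod_t u t.1 t.2 ^+ e t.

Lemma polyfun_monom e : polyfun (monom e).
Proof.
by apply: polyfun_prod => t; apply: polyfun_exp; exact: polyfun_coord.
Qed.

Definition polycoef (P : 'M[R]_n -> {poly R}) :=
  forall k, polyfun (fun u => (P u)`_k).

Lemma polycoefM P Q : polycoef P -> polycoef Q ->
  polycoef (fun u => P u * Q u).
Proof.
move=> pP pQ k; under eq_fun do rewrite coefM.
by apply: polyfun_sum => i; exact: polyfun_mul.
Qed.

Lemma polycoef1 : polycoef (fun=> 1).
Proof. by move=> k; exact: polyfun_cst. Qed.

Lemma polycoef_exp P k : polycoef P -> polycoef (fun u => P u ^+ k).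
Proof.
move=> pP; elim: k => [|k IH].
  by under eq_fun do rewrite expr0; exact: polycoef1.
by under eq_fun do rewrite exprS; exact: polycoefM.
Qed.

Lemma polycoef_prod I (r : seq I) (F : I -> 'M[R]_n -> {poly R}) :
  (forall i, polycoef (F i)) -> polycoef (fun u => \prod_(i <- r) F i u).
Proof.
move=> pF; elim: r => [|i r IH].
  by under eq_fun do rewrite big_nil; exact: polycoef1.
by under eq_fun do rewrite big_cons; exact: polycoefM.
Qed.

Section Rotation.
Variables (i j : 'I_n) (ij : i != j).
Let s : 'I_n -> 'I_n := tperm i j.
Let kap r : R := (r == j)%:R - (r == i)%:R.

(** The degree bound D is uniform in u, so the mean is again a polynomial in x, to which
    [even_poly_coef1] can be applied. *)
Lemma haar_mean_horner (P : 'M[R]_n -> {poly R}) D :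
  polycoef P -> (forall u, size (P u) <= D)%N -> forall x,
  haar_mean (fun u => (P u).[x]) =
  (\poly_(k < D) haar_mean (fun u => (P u)`_k)).[x].
Proof.
move=> pP sP x; rewrite horner_poly.
under eq_fun do rewrite (horner_coef_wide _ (sP _)).
under eq_fun do under eq_bigr do rewrite mulrC.
rewrite haar_mean_sum => [|k]; last first.
  by apply: polyfun_mul; [exact: polyfun_cst|exact: pP].
by apply: eq_bigr => k _; rewrite haar_meanZ 1?mulrC//; exact: pP.
Qed.

(** [rot tau] is the rotation of rows i and j by the angle arctan tau, with the signs of its
    off-diagonal entries given by [kap]. Multiplying these rows by [scale] makes the entries
    polynomial in tau. *)
Let scale (tau : R) r : R := if s r == r then 1 else Num.sqrt (1 + tau ^+ 2).
Let rot tau : 'M[R]_n := \matrix_(r < n, k < n)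
  ((k == r)%:R * (scale tau r)^-1 +
   (k == s r)%:R * (tau * kap r / scale tau r)).

Lemma rot_mulmx tau (u : 'M[R]_n) r k :
  (rot tau *m u) r k = (u r k + tau * kap r * u (s r) k) / scale tau r.
Proof.
rewrite mxE.
under eq_bigr do rewrite mxE mulrDl.
rewrite big_split /= (bigD1 r)//= big1 => [|l /negPf ->]; last by rewrite !mul0r.
rewrite (bigD1 (s r))//= big1 => [|l /negPf ->]; last by rewrite !mul0r.
by rewrite !eqxx /= !mul1r !addr0 mulrDl (mulrC _ (u r k)) mulrAC.
Qed.

Lemma kap_fix r : s r = r -> kap r = 0.
Proof.
rewrite /s /kap; case: tpermP => [->|->|/eqP/negPf -> /eqP/negPf ->];
  by rewrite ?subrr// => ji; move: ij; rewrite ji eqxx.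
Qed.

Lemma kap_move r : s r != r -> kap r ^+ 2 = 1 /\ kap (s r) = - kap r.
Proof.
rewrite /s /kap; case: tpermP => [->|->|]; last by rewrite eqxx.
- by rewrite !eqxx (eq_sym j i) (negPf ij)/= => _; split; ring.
- by rewrite !eqxx (eq_sym j i) (negPf ij)/= => _; split; ring.
Qed.

Lemma scale_neq0 tau r : scale tau r != 0.
Proof.
rewrite /scale; case: ifP => _; first exact: oner_neq0.
by rewrite sqrtr_eq0 -ltNge ltr_wpDr// sqr_ge0.
Qed.

Lemma rot_orthogonal tau : orthogonal_group R n (rot tau).
Proof.
apply/matrixP => r r'; rewrite rot_mulmx !mxE.
rewrite (inj_eq (@perm_inj _ (tperm i j))) -/(s r).
have ss : s (s r) = r by rewrite /s tpermK.
have -> : (r == s r') = (s r == r').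
  by rewrite -[r in LHS]ss (inj_eq (@perm_inj _ (tperm i j))).
have [rr|rr] := eqVneq (s r) r.
  rewrite (kap_fix rr) rr /scale rr eqxx.
  have [<-|rr'] := eqVneq r r'; last by rewrite /= !mul0r; ring.
  by rewrite (kap_fix rr) rr eqxx; field.
have [k2 ks] := kap_move rr.
have sc : scale tau r ^+ 2 = 1 + tau ^+ 2.
  by rewrite /scale (negPf rr) sqr_sqrtr// addr_ge0// sqr_ge0.
have [<-|rr'] := eqVneq r r'.
  have := scale_neq0 tau r => s0.
  transitivity ((1 + tau ^+ 2 * kap r ^+ 2) / scale tau r ^+ 2).
    by rewrite (negPf rr)/=; field.
  by rewrite k2 mulr1 -sc divff// expf_neq0.
have [<-|rr''] := eqVneq (s r) r'; last by rewrite /= !mul0r; ring.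
have scs : scale tau (s r) = scale tau r.
  by rewrite /scale ss eq_sym (negPf rr).
by rewrite ks scs /=; ring.
Qed.

Lemma haar_rotation (e : 'I_n * 'I_n -> nat) :
  haar_mean (fun u => \sum_t (e t)%:R * (kap t.1 * u (s t.1) t.2) *
    monom (fun t' => e t' - (t' == t))%N u) = 0.
Proof.
(* [P u] evaluated at tau is the monomial at [rot tau *m u] with rows i and j
   multiplied by sqrt(1 + tau^2), so its mean is an even function of tau. *)
pose P (u : 'M[R]_n) : {poly R} :=
  \prod_t ((u t.1 t.2)%:P + (kap t.1 * u (s t.1) t.2)%:P * 'X) ^+ e t.
have pP : polycoef P.
  apply: polycoef_prod => t; apply: polycoef_exp => k.
  under eq_fun do rewrite coefD coefC coefMX coefC.
  apply: polyfun_add; first by case: k => [|k]; [exact: polyfun_coord|exact: polyfun_cst].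
  case: k => [|[|k]] /=; try exact: polyfun_cst.
  by apply: polyfun_mul; [exact: polyfun_cst|exact: polyfun_coord].
have [D sP] : exists D, forall u, (size (P u) <= D)%N.
  exists (\sum_t (e t).+1).+1 => u.
  apply: leq_trans (size_poly_prod_leq _ _) _.
  apply: leq_trans (leq_subr _ _) _; rewrite ltnS; apply: leq_sum => t _.
  apply: leq_trans (size_poly_exp_leq _ _) _; rewrite ltnS -[leqRHS]mul1n.
  rewrite leq_mul2r; apply/orP; right; rewrite -subn1 leq_subLR.
  rewrite addrC -cons_poly_def size_cons_poly.
  by case: ifP => // _; rewrite ltnS size_polyC; case: (_ != _).
have PE u tau : (P u).[tau] =
    (\prod_t scale tau t.1 ^+ e t) * monom e (rot tau *m u).
  rewrite /P /monom -big_split/= horner_prod; apply: eq_bigr => t _.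
  rewrite horner_exp !hornerE -exprMn rot_mulmx; congr (_ ^+ _).
  by rewrite [RHS]mulrC divfK ?scale_neq0//; ring.
have H1 : (\poly_(k < D) haar_mean (fun u => (P u)`_k))`_1 = 0.
  apply: even_poly_coef1 => tau.
  rewrite -!(haar_mean_horner pP sP).
  have HE x : haar_mean (fun u => (P u).[x]) =
      (\prod_t scale x t.1 ^+ e t) * haar_mean (monom e).
    under eq_fun do rewrite PE.
    have pe := polyfun_monom e.
    have pc : polyfun (fun u => monom e (rot x *m u)).
      by apply: (polyfun_comp _ pe) => r k; exact: polyfun_mulmx.
    by rewrite haar_meanZ// haar_mean_mulmx//; exact: rot_orthogonal.
  by rewrite !HE /scale sqrrN.
rewrite -[RHS]H1.
have -> : (\poly_(k < D) haar_mean (fun u => (P u)`_k))`_1 = haar_mean (fun u => (P u)`_1).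
  rewrite coef_poly; case: ltnP => // D1.
  under eq_fun do rewrite nth_default ?(leq_trans (sP _))//.
  by rewrite haar_mean_cst.
(* The linear coefficient of [P u] is its derivative at 0, computed by the Leibniz rule. *)
apply: eq_haar_mean => u _.
rewrite coef1_horner /P deriv_prod horner_sum; apply: eq_bigr => t _.
rewrite hornerM horner_prod deriv_exp derivD derivM derivX !derivC.
rewrite [in LHS]/monom (bigD1 t)//= eqxx subn1.
rewrite hornerMn hornerM horner_exp !hornerE ?(mulr0, addr0, add0r).
rewrite /= -[in RHS]mulr_natl -!mulrA; do 4 congr (_ * _).
apply: eq_bigr => t' /negPf ->.
by rewrite horner_exp !hornerE ?(mulr0, addr0) subn0.
Qed.


End Rotation.

(** * Moments *)

Definition moment e := haar_mean (monom e).

Lemma eq_moment e e' : e =1 e' -> moment e = moment e'.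
Proof. by move=> ee'; congr (moment _); exact/funext. Qed.

Lemma monomM e (t : 'I_n * 'I_n) (u : 'M[R]_n) :
  u t.1 t.2 * monom e u = monom (fun t' => e t' + (t' == t))%N u.
Proof.
rewrite /monom [LHS]mulrC (bigD1 t)//= [RHS](bigD1 t)//= eqxx addn1 exprSr.
rewrite mulrAC; congr (_ * _); apply: eq_bigr => t' /negPf ->.
by rewrite addn0.
Qed.

Lemma polyfun_coordM c (t : 'I_n * 'I_n) e :
  polyfun (fun u => c * u t.1 t.2 * monom e u).
Proof.
apply: polyfun_mul; last exact: polyfun_monom.
by apply: polyfun_mul; [exact: polyfun_cst|exact: polyfun_coord].
Qed.

(** This is [haar_rotation] read on exponents: each term replaces one factor of row i or j by the
    entry of the other row in the same column. *)
Lemma moment_rows i j e : i != j ->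
  \sum_k (e (j, k))%:R * moment (fun t => e t - (t == (j, k)) + (t == (i, k)))%N =
  \sum_k (e (i, k))%:R * moment (fun t => e t - (t == (i, k)) + (t == (j, k)))%N.
Proof.
move=> ij; apply/eqP; rewrite -subr_eq0; apply/eqP.
rewrite -[RHS](haar_rotation ij e).
have E t : haar_mean (fun u => (e t)%:R * (((t.1 == j)%:R - (t.1 == i)%:R) *
      u (tperm i j t.1) t.2) * monom (fun t' => e t' - (t' == t))%N u) =
    (e t)%:R * ((t.1 == j)%:R - (t.1 == i)%:R) *
    moment (fun t' => e t' - (t' == t) + (t' == (tperm i j t.1, t.2)))%N.
  rewrite -haar_meanZ; last exact: polyfun_monom.
  by apply: eq_haar_mean => u _; rewrite -monomM /=; ring.
rewrite haar_mean_sum => [|t]; last first.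
  under eq_fun do rewrite mulrA.
  exact: (polyfun_coordM _ (tperm i j t.1, t.2)).
under [RHS]eq_bigr do rewrite E.
transitivity (\sum_r \sum_k (e (r, k))%:R * ((r == j)%:R - (r == i)%:R) *
    moment (fun t' => e t' - (t' == (r, k)) + (t' == (tperm i j r, k)))%N);
  last by rewrite pair_bigA; apply: eq_bigr => -[r k].
rewrite [RHS](bigD1 j)//= [X in _ = _ + X](bigD1 i)//=
  [X in _ = _ + (_ + X)]big1 => [|r /andP[/negPf rj /negPf ri]].
  rewrite addr0 -sumrN; congr (_ + _); apply: eq_bigr => k _.
    by rewrite eqxx eq_sym (negPf ij) tpermR /= subr0 mulr1.
  by rewrite eqxx (negPf ij) tpermL /= sub0r mulrN1 mulNr.
by rewrite big1// => k _; rewrite rj ri subrr mulr0 mul0r.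
Qed.

Lemma moment_tr e : moment (fun t => e (t.2, t.1)) = moment e.
Proof.
rewrite /moment -[RHS]haar_mean_trmx; last exact: polyfun_monom.
apply: eq_haar_mean => u _; rewrite /monom.
rewrite (reindex_inj (h := fun t : 'I_n * 'I_n => (t.2, t.1))) => [|[? ?] [? ?] [-> ->] //].
by apply: eq_bigr => -[r k] _ /=; rewrite mxE.
Qed.

Lemma moment_cols i j e : i != j ->
  \sum_k (e (k, j))%:R * moment (fun t => e t - (t == (k, j)) + (t == (k, i)))%N =
  \sum_k (e (k, i))%:R * moment (fun t => e t - (t == (k, i)) + (t == (k, j)))%N.
Proof.
move=> ij; have := moment_rows (fun t => e (t.2, t.1)) ij.
have sw (t : 'I_n * 'I_n) r k : ((t.2, t.1) == (r, k)) = (t == (k, r)).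
  by case: t => x y; rewrite !xpair_eqE andbC.
under eq_bigr do rewrite -moment_tr; under [X in _ = X]eq_bigr do rewrite -moment_tr.
under eq_bigr do under eq_moment do rewrite /= !sw -surjective_pairing.
by under [X in _ = X -> _]eq_bigr do under eq_moment do rewrite /= !sw -surjective_pairing.
Qed.

Lemma moment_orthonormal r r' e :
  \sum_k moment (fun t => e t + (t == (r, k)) + (t == (r', k)))%N =
  (r == r')%:R * moment e.
Proof.
rewrite /moment -haar_mean_sum => [|k]; last exact: polyfun_monom.
rewrite -haar_meanZ; last exact: polyfun_monom.
apply: eq_haar_mean => u uu.
have /matrixP/(_ r' r) := uu; rewrite !mxE eq_sym => <-.
rewrite mulr_suml; apply: eq_bigr => k _.
by rewrite -monomM -monomM mxE mulrA.
Qed.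

(** Negating row r is an orthogonal transformation that changes the sign of the monomial. *)
Lemma moment_odd r e : odd (\sum_k e (r, k))%N -> moment e = 0.
Proof.
move=> oe; pose sg i : R := (-1) ^+ (i == r).
pose g : 'M[R]_n := diag_mx (\row_i sg i).
have gE (u : 'M[R]_n) i k : (g *m u) i k = sg i * u i k.
  by rewrite mul_diag_mx !mxE.
have og : orthogonal_group R n g.
  apply/matrixP => i k; rewrite gE !mxE (eq_sym i k).
  have [->|_] := eqVneq k i; last by rewrite mulr0.
  by rewrite -expr2 /sg; case: (_ == _); rewrite ?sqrrN expr1n.
have : moment e = - moment e.
  have pe := polyfun_monom e.
  rewrite {1}/moment -(haar_mean_mulmx og)// -mulN1r -haar_meanZ//.
  apply: eq_haar_mean => u _; rewrite /monom.
  under eq_bigr do rewrite gE exprMn.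
  rewrite big_split/=; congr (_ * _).
  transitivity (\prod_i \prod_k sg i ^+ e (i, k)).
    by rewrite pair_bigA; apply: eq_bigr => -[i k].
  rewrite (bigD1 r)//= [X in _ * X]big1 => [|i /negPf ir].
    by rewrite mulr1 -expr_sum /sg eqxx expr1 -signr_odd oe expr1.
  by rewrite big1// => k _; rewrite /sg ir expr1n.
by move/eqP; rewrite -addr_eq0 -mulr2n mulrn_eq0 => /eqP.
Qed.

Lemma moment0 : moment (fun=> 0%N) = 1.
Proof.
rewrite /moment -[RHS](haar_mean_cst 1); apply: eq_haar_mean => u _.
by rewrite /monom big1.
Qed.

(** * Moments supported on two rows *)

Definition row_exp r0 r1 (a b : 'I_n -> nat) (t : 'I_n * 'I_n) : nat :=
  if t.1 == r0 then a t.2 else if t.1 == r1 then b t.2 else 0%N.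

Definition moment2 r0 r1 a b := moment (row_exp r0 r1 a b).

Lemma moment2C r0 r1 a b : r0 != r1 -> moment2 r0 r1 a b = moment2 r1 r0 b a.
Proof.
move=> r01; apply: eq_moment => -[r k]; rewrite /row_exp /=.
by have [->|//] := eqVneq r r0; rewrite (negPf r01).
Qed.

Lemma eq_moment2 r0 r1 a a' b b' : a =1 a' -> b =1 b' ->
  moment2 r0 r1 a b = moment2 r0 r1 a' b'.
Proof. by move=> aa bb; congr moment2; exact/funext. Qed.

Lemma moment2_rows r0 r1 a b : r0 != r1 ->
  \sum_k (b k)%:R * moment2 r0 r1 (incr a k) (decr b k) =
  \sum_k (a k)%:R * moment2 r0 r1 (decr a k) (incr b k).
Proof.
move=> r01; have := moment_rows (row_exp r0 r1 a b) r01.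
have r10 : (r1 == r0) = false by rewrite eq_sym (negPf r01).
have E1 : \sum_k (row_exp r0 r1 a b (r1, k))%:R * moment (fun t =>
      row_exp r0 r1 a b t - (t == (r1, k)) + (t == (r0, k)))%N =
    \sum_k (b k)%:R * moment2 r0 r1 (incr a k) (decr b k).
  apply: eq_bigr => k _; rewrite {1}/row_exp /= eqxx r10; congr (_ * _).
  apply: eq_moment => -[r l]; rewrite /row_exp !xpair_eqE /= /incr /decr.
  have [->|_] := eqVneq r r0; first by rewrite (negPf r01) subn0.
  by have [|] := eqVneq r r1; rewrite ?addn0.
have E2 : \sum_k (row_exp r0 r1 a b (r0, k))%:R * moment (fun t =>
      row_exp r0 r1 a b t - (t == (r0, k)) + (t == (r1, k)))%N =
    \sum_k (a k)%:R * moment2 r0 r1 (decr a k) (incr b k).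
  apply: eq_bigr => k _; rewrite {1}/row_exp /= eqxx; congr (_ * _).
  apply: eq_moment => -[r l]; rewrite /row_exp !xpair_eqE /= /incr /decr.
  have [->|_] := eqVneq r r0; first by rewrite (negPf r01) addn0.
  by have [|] := eqVneq r r1; rewrite ?subn0.
by rewrite E1 E2.
Qed.

Lemma moment2_cols r0 r1 a b i j : r0 != r1 -> i != j ->
  (a j)%:R * moment2 r0 r1 (incr (decr a j) i) b +
    (b j)%:R * moment2 r0 r1 a (incr (decr b j) i) =
  (a i)%:R * moment2 r0 r1 (incr (decr a i) j) b +
    (b i)%:R * moment2 r0 r1 a (incr (decr b i) j).
Proof.
move=> r01 ij; have := moment_cols (row_exp r0 r1 a b) ij.
have E (k l : 'I_n) : \sum_r (row_exp r0 r1 a b (r, k))%:R *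
      moment (fun t => row_exp r0 r1 a b t - (t == (r, k)) + (t == (r, l)))%N =
    (a k)%:R * moment2 r0 r1 (incr (decr a k) l) b +
    (b k)%:R * moment2 r0 r1 a (incr (decr b k) l).
  rewrite (bigD1 r0)//= (bigD1 r1)/=; last by rewrite eq_sym.
  rewrite big1 => [|r /andP[/negPf rr0 /negPf rr1]]; last first.
    by rewrite /row_exp /= rr0 rr1 mul0r.
  have -> : row_exp r0 r1 a b (r0, k) = a k by rewrite /row_exp /= eqxx.
  have -> : row_exp r0 r1 a b (r1, k) = b k.
    by rewrite /row_exp /= eqxx eq_sym (negPf r01).
  rewrite addr0; congr (_ * _ + _ * _); apply: eq_moment => -[r m];
    rewrite /row_exp !xpair_eqE /= /incr /decr.
    by have [//|] := eqVneq r r0; rewrite subn0 addn0.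
  have [->|_] := eqVneq r r0; first by rewrite (negPf r01) subn0 addn0.
  by have [//|] := eqVneq r r1.
by rewrite !E.
Qed.

Lemma moment2_norm r0 r1 a b : r0 != r1 ->
  \sum_k moment2 r0 r1 (incr (incr a k) k) b = moment2 r0 r1 a b.
Proof.
move=> r01; have := moment_orthonormal r0 r0 (row_exp r0 r1 a b).
rewrite eqxx mul1r => e2; rewrite -[RHS]e2.
apply: eq_bigr => k _; apply: eq_moment => -[r m].
rewrite /row_exp !xpair_eqE /= /incr.
by have [//|] := eqVneq r r0; rewrite !addn0.
Qed.

Lemma moment2_orthogonal r0 r1 a b : r0 != r1 ->
  \sum_k moment2 r0 r1 (incr a k) (incr b k) = 0.
Proof.
move=> r01.
have := moment_orthonormal r0 r1 (row_exp r0 r1 a b).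
rewrite (negPf r01) mul0r => e0; rewrite -[RHS]e0.
apply: eq_bigr => k _; apply: eq_moment => -[r m].
rewrite /row_exp !xpair_eqE /= /incr.
have [->|_] := eqVneq r r0; first by rewrite (negPf r01) addn0.
by have [//|] := eqVneq r r1; rewrite !addn0.
Qed.

Lemma moment2_odd r0 r1 a b : odd (\sum_k a k)%N -> moment2 r0 r1 a b = 0.
Proof.
by move=> oa; apply: (@moment_odd r0); under eq_bigr do rewrite /row_exp /= eqxx.
Qed.

Lemma moment2_0 r0 r1 : moment2 r0 r1 (fun=> 0%N) (fun=> 0%N) = 1.
Proof.
rewrite -[RHS]moment0; apply: eq_moment => t.
by rewrite /row_exp; case: (t.1 == r0); case: (t.1 == r1).
Qed.

(** Sum over i the column relation for columns i and j applied to [incr a i]. The unit norm of row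
    r0 collapses the first sum, and the orthogonality of the two rows kills the second. *)
Lemma moment2_sphere r0 r1 a b j : r0 != r1 ->
  (a j)%:R * moment2 r0 r1 (decr a j) b =
  ((\sum_k a k)%:R + n%:R - 1) * moment2 r0 r1 (incr a j) b +
  \sum_k (b k)%:R * moment2 r0 r1 (incr a k) (incr (decr b k) j).
Proof.
move=> r01.
have E i : (a j)%:R * moment2 r0 r1 (incr (incr (decr a j) i) i) b +
      (b j)%:R * moment2 r0 r1 (incr a i) (incr (decr b j) i) =
    (a i + (i != j))%:R * moment2 r0 r1 (incr a j) b +
      (b i)%:R * moment2 r0 r1 (incr a i) (incr (decr b i) j).
  have [->|ij] := eqVneq i j.
    rewrite addn0; congr (_ + _); have [->|aj] := posnP (a j); first by rewrite !mul0r.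
    congr (_ * _); apply: eq_moment2 => // l; rewrite /incr /decr.
    by have [->|] := eqVneq l j; lia.
  have := moment2_cols (incr a i) b r01 ij.
  have -> : incr a i j = a j by rewrite /incr eq_sym (negPf ij) addn0.
  have -> : incr a i i = (a i + ~~ false)%N by rewrite /incr eqxx.
  have -> : moment2 r0 r1 (incr (decr (incr a i) j) i) b =
      moment2 r0 r1 (incr (incr (decr a j) i) i) b.
    apply: eq_moment2 => // l; rewrite /incr /decr.
    by have [->|] := eqVneq l j; rewrite ?(eq_sym j) ?(negPf ij); lia.
  have -> // : moment2 r0 r1 (incr (decr (incr a i) i) j) b =
      moment2 r0 r1 (incr a j) b.
  by apply: eq_moment2 => // l; rewrite /incr /decr addnK.
have : \sum_i ((a j)%:R * moment2 r0 r1 (incr (incr (decr a j) i) i) b +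
      (b j)%:R * moment2 r0 r1 (incr a i) (incr (decr b j) i)) =
    \sum_i ((a i + (i != j))%:R * moment2 r0 r1 (incr a j) b +
      (b i)%:R * moment2 r0 r1 (incr a i) (incr (decr b i) j)).
  by apply: eq_bigr => i _; exact: E.
rewrite !big_split/= -!mulr_sumr -mulr_suml -natr_sum moment2_norm//.
rewrite moment2_orthogonal// mulr0 addr0 => ->; congr (_ * _ + _).
rewrite big_split/= natrD -addrA; congr (_ + _).
(* The constant n - 1 counts the columns other than j. *)
rewrite -[n in RHS]card_ord -sum1_card (bigD1 j)//= [in RHS](bigD1 j)//= eqxx add0n.
rewrite natrD addrAC subrr add0r; congr _%:R.
by apply: eq_bigr => i ->.
Qed.

(** The row relation at [(a, incr b j)] rewrites the last sum of [moment2_sphere]; the extra unit in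
    column j costs one copy of [moment2 r0 r1 (incr a j) b], turning n - 1 into n - 2. *)
Lemma moment2_recursion r0 r1 a b j : r0 != r1 ->
  (a j)%:R * moment2 r0 r1 (decr a j) b =
  ((\sum_k a k)%:R + n%:R - 2) * moment2 r0 r1 (incr a j) b +
  \sum_k (a k)%:R * moment2 r0 r1 (decr a k) (incr (incr b k) j).
Proof.
move=> r01; rewrite moment2_sphere//.
have := moment2_rows a (incr b j) r01.
have -> : \sum_k (incr b j k)%:R * moment2 r0 r1 (incr a k) (decr (incr b j) k) =
    \sum_k (b k)%:R * moment2 r0 r1 (incr a k) (incr (decr b k) j) +
    moment2 r0 r1 (incr a j) b.
  rewrite (bigD1 j)//= [in RHS](bigD1 j)//= addrAC; congr (_ + _).
    rewrite {1}/incr eqxx natrD mulrDl mul1r; congr (_ + _); last first.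
      by apply: eq_moment2 => // l; rewrite /incr /decr addnK.
    have [->|bj] := posnP (b j); first by rewrite !mul0r.
    congr (_ * _); apply: eq_moment2 => // l; rewrite /incr /decr.
    by have [->|] := eqVneq l j; lia.
  apply: eq_bigr => k kj; rewrite {1}/incr (negPf kj) addn0; congr (_ * _).
  apply: eq_moment2 => // l; rewrite /incr /decr.
  by have [->|] := eqVneq l k; rewrite ?(negPf kj); lia.
have -> : \sum_k (a k)%:R * moment2 r0 r1 (decr a k) (incr (incr b j) k) =
    \sum_k (a k)%:R * moment2 r0 r1 (decr a k) (incr (incr b k) j).
  apply: eq_bigr => k _; congr (_ * _); apply: eq_moment2 => // l.
  by rewrite /incr addnAC.
by move=> <-; ring.
Qed.

Lemma moment2_value r0 r1 a b : r0 != r1 -> (1 < n)%N ->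
  moment2 r0 r1 a b = two_row_value R n a b.
Proof.
move=> r01 n1; apply: (two_row_value_unique n1 (M := moment2 r0 r1)) => {a b}.
- exact: moment2_0.
- by move=> a b; exact: moment2_odd.
(* After exchanging the rows, the second one is empty and the last sum of [moment2_sphere]
   vanishes. *)
- move=> b j; rewrite !(moment2C _ _ r01) moment2_sphere; last by rewrite eq_sym.
  by rewrite [X in _ + X]big1 ?addr0// => k _; rewrite mul0r.
- move=> a b j; rewrite moment2_recursion//; congr (_ + _).
  apply: eq_bigr => k _; congr (_ * _); apply: eq_moment2 => // l.
  by rewrite /incr addnAC.
Qed.

End PolynomialFunctions.

(** * The function phi *)

Section PhiFormula.
Variable R : realType.

(** Padding by zeros turns the exponents of q columns into exponents on all n columns; an added
    column contributes the factor [pairing R 0 0], which is 1. *)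
Definition extend q n (f : 'I_q -> nat) (k : 'I_n) : nat :=
  oapp f 0%N (insub (val k)).

Lemma extend_widen q n (hq : (q <= n)%N) (f : 'I_q -> nat) t :
  extend f (widen_ord hq t) = f t.
Proof.
rewrite /extend; have -> : insub (val (widen_ord hq t)) = Some t by rewrite valK.
by [].
Qed.

Lemma extend_out q n (f : 'I_q -> nat) (k : 'I_n) : (q <= k)%N ->
  extend f k = 0%N.
Proof. by move=> qk; rewrite /extend insubF// ltnNge qk. Qed.

Lemma big_widen (T : Type) (idx : T) (op : Monoid.com_law idx) q n
    (hq : (q <= n)%N) (G : 'I_n -> T) :
  (forall k : 'I_n, (q <= k)%N -> G k = idx) ->
  \big[op/idx]_(k < n) G k = \big[op/idx]_(t < q) G (widen_ord hq t).
Proof.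
move=> G1; rewrite -(big_ord_narrow hq) [RHS]big_mkcond.
by apply: eq_bigr => k _; case: ltnP => // /G1.
Qed.

Definition phi_value (n : nat) q (x : 'M[nat]_(2, q)) : R :=
  beta (\sum_t x ord0 t + \sum_t x ord_max t + n)
    (\prod_t pairing R (x ord0 t) (x ord_max t)) /
  ((\prod_t (dfact (x ord0 t) * dfact (x ord_max t)))%:R *
   wprod (dfact_shift R n) (\prod_t (column_poly x t - 1))).

Lemma ord_max2 : lift ord0 ord0 = ord_max :> 'I_2.
Proof. exact: val_inj. Qed.

Lemma I_int_value n (mu : probability (borel_mx R n) R) (mu_haar : is_haar mu)
    (hn : (2 <= n)%N) q (hq : (q <= n)%N) (x : 'M[nat]_(2, q)) :
  I_int mu hn hq x =
  (dfact (n - 2) * dfact (n - 1))%:R *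
  beta (\sum_t x ord0 t + \sum_t x ord_max t + n)
    (\prod_t pairing R (x ord0 t) (x ord_max t)) /
  (dfact (\sum_t x ord0 t + n - 2) * dfact (\sum_t x ord_max t + n - 2) *
   dfact (\sum_t x ord0 t + \sum_t x ord_max t + n - 1))%:R.
Proof.
pose r0 : 'I_n := widen_ord hn ord0; pose r1 : 'I_n := widen_ord hn ord_max.
have r01 : r0 != r1 by [].
pose a : 'I_n -> nat := extend (x ord0); pose b : 'I_n -> nat := extend (x ord_max).
transitivity (moment2 mu r0 r1 a b).
  apply: eq_haar_mean => u _; rewrite /monom.
  transitivity (\prod_r \prod_k u r k ^+ row_exp r0 r1 a b (r, k)); last first.
    by rewrite pair_bigA; apply: eq_bigr => -[r k].
  rewrite (@big_widen _ _ _ _ _ hn) => [|r r2]; last first.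
    rewrite big1// => k _; rewrite /row_exp /=.
    case: eqP => [rr|_]; first by rewrite rr in r2.
    by case: eqP => [rr|_]; first by rewrite rr in r2.
  rewrite !big_ord_recl !big_ord0 !mulr1 ord_max2 -/r0 -/r1.
  have ext_prod (y : 'I_q -> nat) (r : 'I_n) :
      \prod_(k < n) u r k ^+ extend y k = \prod_(t < q) u r (widen_ord hq t) ^+ y t.
    rewrite (@big_widen _ _ _ _ _ hq) => [|k qk]; last by rewrite extend_out.
    by apply: eq_bigr => t _; rewrite extend_widen.
  by rewrite -!ext_prod /= mulr1; congr (_ * _); apply: eq_bigr => k _.
rewrite moment2_value// /two_row_value.
have ext_sum (y : 'I_q -> nat) : (\sum_(k < n) extend y k = \sum_(t < q) y t)%N.
  rewrite (@big_widen _ _ _ _ _ hq) => [|k qk]; last by rewrite extend_out.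
  by apply: eq_bigr => t _; rewrite extend_widen.
rewrite !ext_sum /pairings.
have -> // : \prod_k pairing R (a k) (b k) =
    \prod_t pairing R (x ord0 t) (x ord_max t).
rewrite (@big_widen _ _ _ _ _ hq) => [|k qk]; last first.
  by rewrite /a /b !extend_out// pairing0 dfact0.
by apply: eq_bigr => t _; rewrite /a /b !extend_widen.
Qed.

(** All double factorials in n, A and B cancel between the moment, the normalisation of J and the
    prefactor of Gamma; [Gamma_ratio] removes the products over odd q - r. *)
Lemma phi_formula n (mu : probability (borel_mx R n) R) (mu_haar : is_haar mu)
    (hn : (2 <= n)%N) q (hq : (q <= n)%N) (x : 'M[nat]_(2, q)) :
  phi mu hn hq x = phi_value n x.
Proof.
rewrite /phi /J_int /Gamma_fac I_int_value// /phi_value.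
rewrite !big_ord_recl !big_ord0 !muln1 !addn0 ord_max2.
rewrite !natrM Gamma_ratio big_split/= !natrM.
set be := beta _ _; set w := wprod _ _.
have w0 : w != 0 by apply: wprod_neq0; exact: dfact_shift_neq0.
have neq0 m : (dfact m)%:R != 0 :> R by rewrite pnatr_eq0 -lt0n dfact_gt0.
set od := (\prod_(0 <= r < q.+1 | _) _)%:R.
have od0 : od != 0.
  rewrite pnatr_eq0 -lt0n; apply: prodn_gt0 => r.
  by apply: prodn_gt0 => m; exact: dfact_gt0.
have da0 : (\prod_t dfact (x ord0 t))%:R != 0 :> R.
  by rewrite pnatr_eq0 -lt0n; apply: prodn_gt0 => t; exact: dfact_gt0.
have db0 : (\prod_t dfact (x ord_max t))%:R != 0 :> R.
  by rewrite pnatr_eq0 -lt0n; apply: prodn_gt0 => t; exact: dfact_gt0.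
have n1 := neq0 (n - 1)%N; have n2 := neq0 (n - 2)%N.
have nA := neq0 (\sum_t x ord0 t + n - 2)%N.
have nB := neq0 (\sum_t x ord_max t + n - 2)%N.
have nS := neq0 (\sum_t x ord0 t + \sum_t x ord_max t + n - 1)%N.
by field; rewrite w0 db0 da0 od0 nB nA n2 nS n1.
Qed.

(** * Symmetries read off from the closed formula *)

Definition phi_rows (n q : nat) (a b : 'rV[nat]_q) : R :=
  beta (\sum_t a ord0 t + \sum_t b ord0 t + n)
    (\prod_t pairing R (a ord0 t) (b ord0 t)) /
  ((\prod_t (dfact (a ord0 t) * dfact (b ord0 t)))%:R *
   wprod (dfact_shift R n) (\prod_t ('X^(a ord0 t) + 'X^(b ord0 t) - 1))).

Lemma phi_value_rows n q (x : 'M[nat]_(2, q)) :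
  phi_value n x = phi_rows n (row ord0 x) (row ord_max x).
Proof.
rewrite /phi_value /phi_rows /column_poly.
congr (beta (_ + _ + _) _ / (_%:R * wprod _ _)); apply: eq_bigr => t _;
  by rewrite !mxE.
Qed.

Lemma row_col_mx0 q (a b : 'rV[nat]_q) : row (ord0 : 'I_2) (col_mx a b) = a.
Proof.
have e : (ord0 : 'I_2) = lshift 1 (ord0 : 'I_1) by exact: val_inj.
by apply/rowP => t; rewrite mxE e; exact: col_mxEu.
Qed.

Lemma row_col_mx1 q (a b : 'rV[nat]_q) : row (ord_max : 'I_2) (col_mx a b) = b.
Proof.
have e : (ord_max : 'I_2) = rshift 1 (ord0 : 'I_1) by exact: val_inj.
by apply/rowP => t; rewrite mxE e; exact: col_mxEd.
Qed.

Section HaarMeasure.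
Variables (n : nat) (mu : probability (borel_mx R n) R) (mu_haar : is_haar mu).
Variable hn : (2 <= n)%N.

Lemma phi_col q (hq : (q <= n)%N) (a b : 'rV[nat]_q) :
  phi mu hn hq (col_mx a b) = phi_rows n a b.
Proof. by rewrite phi_formula// phi_value_rows row_col_mx0 row_col_mx1. Qed.

Lemma phi_block q s (hqs : (q + s <= n)%N) (a b : 'rV[nat]_q) (c d : 'rV[nat]_s) :
  phi mu hn hqs (block_mx a c b d) = phi_rows n (row_mx a c) (row_mx b d).
Proof. exact: phi_col. Qed.

End HaarMeasure.

Lemma phi_rowsC n q (a b : 'rV[nat]_q) : phi_rows n a b = phi_rows n b a.
Proof.
rewrite /phi_rows; congr (beta (_ + _) _ / (_%:R * wprod _ _)).
- exact: addnC.
- by apply: eq_bigr => t _; rewrite pairingC.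
- by apply: eq_bigr => t _; rewrite mulnC.
- by apply: eq_bigr => t _; rewrite [X in X - _]addrC.
Qed.

Lemma phi_rows_perm n q (a b : 'rV[nat]_q) (s : 'S_q) :
  phi_rows n (col_perm s a) (col_perm s b) = phi_rows n a b.
Proof.
rewrite /phi_rows; congr (beta (_ + _ + _) _ / (_%:R * wprod _ _));
  by rewrite [RHS](reindex_inj (@perm_inj _ s)); apply: eq_bigr => t _; rewrite !mxE.
Qed.

Lemma big_row_mx (T : Type) (idx : T) (op : Monoid.law idx) q s
    (a b : 'rV[nat]_q) (c d : 'rV[nat]_s) (F : nat -> nat -> T) :
  \big[op/idx]_t F (row_mx a c ord0 t) (row_mx b d ord0 t) =
  op (\big[op/idx]_t F (a ord0 t) (b ord0 t))
     (\big[op/idx]_t F (c ord0 t) (d ord0 t)).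
Proof.
rewrite big_split_ord; congr (op _ _); apply: eq_bigr => t _.
  by rewrite !row_mxEl.
by rewrite !row_mxEr.
Qed.

Lemma phi_rows_flip n q s (a b : 'rV[nat]_q) (c d : 'rV[nat]_s) :
  phi_rows n (row_mx a c) (row_mx b d) = phi_rows n (row_mx a d) (row_mx b c).
Proof.
(* Only the sum of the two row totals occurs, so it too is a sum of symmetric functions of the
   columns. *)
rewrite /phi_rows -!big_split/=.
rewrite !(big_row_mx _ _ _ _ _ (fun i j => i + j)%N).
rewrite !(big_row_mx _ _ _ _ _ (fun i j => pairing R i j)).
rewrite !(big_row_mx _ _ _ _ _ (fun i j => dfact i * dfact j)%N).
rewrite !(big_row_mx _ _ _ _ _ (fun i j => 'X^i + 'X^j - 1 : {poly int})).
congr (beta (_ + _ + _) (_ * _) / ((_ * _)%:R * wprod _ (_ * _))).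
- by apply: eq_bigr => t _; rewrite addnC.
- by apply: eq_bigr => t _; rewrite pairingC.
- by apply: eq_bigr => t _; rewrite mulnC.
- by apply: eq_bigr => t _; rewrite [X in X - _]addrC.
Qed.

Lemma phi_rows_odd_entry n q s (a b : 'rV[nat]_q) (c : 'rV[nat]_s) t :
  odd (c ord0 t) -> phi_rows n (row_mx a c) (row_mx b 0) = 0.
Proof.
move=> oc; rewrite /phi_rows.
rewrite (big_row_mx _ _ _ _ _ (fun i j => pairing R i j)).
have -> : \prod_l pairing R (c ord0 l) ((0%R : 'rV[nat]_s) ord0 l) = 0.
  by rewrite (bigD1 t)//= mxE pairing0r oc mul0r.
by rewrite /= mulr0 beta0 mul0r.
Qed.

(* A column (c, 0) contributes a factor depending on c only to each of the
   three products, and shifts the dimension by c. *)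
Lemma phi_rows_even n q s (a b : 'rV[nat]_q) (c : 'rV[nat]_s) :
  (forall t, ~~ odd (c ord0 t)) ->
  phi_rows n (row_mx a c) (row_mx b 0) =
  phi_rows (n + \sum_t c ord0 t) a b.
Proof.
move=> ec; rewrite /phi_rows -!big_split/=.
rewrite (big_row_mx _ _ _ _ _ (fun i j => i + j)%N).
rewrite (big_row_mx _ _ _ _ _ (fun i j => pairing R i j)).
rewrite (big_row_mx _ _ _ _ _ (fun i j => dfact i * dfact j)%N).
rewrite (big_row_mx _ _ _ _ _ (fun i j => 'X^i + 'X^j - 1 : {poly int})).
have -> : \prod_t pairing R (c ord0 t) ((0%R : 'rV[nat]_s) ord0 t) =
    (\prod_t dfact (c ord0 t))%:R.
  rewrite natr_prod; apply: eq_bigr => t _.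
  by rewrite mxE pairing0r (negPf (ec t)).
have -> : (\prod_t (dfact (c ord0 t) * dfact ((0%R : 'rV[nat]_s) ord0 t)) =
    \prod_t dfact (c ord0 t))%N.
  by apply: eq_bigr => t _; rewrite mxE dfact0 muln1.
have -> : \prod_t ('X^(c ord0 t) + 'X^((0%R : 'rV[nat]_s) ord0 t) - 1) =
    'X^(\sum_t c ord0 t) :> {poly int}.
  by rewrite expr_sum; apply: eq_bigr => t _; rewrite mxE expr0 addrK.
have -> : (\sum_t (c ord0 t + (0%R : 'rV[nat]_s) ord0 t) = \sum_t c ord0 t)%N.
  by apply: eq_bigr => t _; rewrite mxE addn0.
set C := (\sum_t c ord0 t)%N; set K := (\prod_t dfact (c ord0 t))%N.
have K0 : K%:R != 0 :> R.
  by rewrite pnatr_eq0 -lt0n; apply: prodn_gt0 => t; exact: dfact_gt0.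
rewrite [X in beta _ X]mulrC beta_natl [X in wprod _ X]mulrC wprodMXn.
rewrite (_ : (fun m => dfact_shift R n (C + m)%N) = dfact_shift R (n + C)); last first.
  by apply/funext => m; rewrite /dfact_shift; congr (dfact _)%:R; lia.
rewrite [X in beta X](_ : _ = \sum_t (a ord0 t + b ord0 t) + (n + C))%N;
  last by rewrite /= -addnA [(C + n)%N]addnC.
rewrite natrM. rewrite [_ * K%:R]mulrC -[X in _ / X]mulrA -mulf_div divff// mul1r//.
Qed.

Lemma phi_rows_zero_row n (a : nat) : ~~ odd a -> (2 <= n)%N ->
  phi_rows n (const_mx a : 'rV[nat]_1) 0 = 1.
Proof.
move=> ea n2; rewrite /phi_rows !big_ord1 !mxE pairing0r (negPf ea) dfact0.
rewrite -polyC_natr betaC muln1 expr0 addrK wprodXn addn0 /dfact_shift.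
by rewrite -natrM divff// pnatr_eq0 -lt0n muln_gt0 !dfact_gt0.
Qed.

Lemma phi_rows_odd n q (a b : 'rV[nat]_q) :
  odd (\sum_t b ord0 t) -> phi_rows n a b = 0.
Proof.
move=> ob; rewrite phi_rowsC /phi_rows.
by rewrite (@beta_pairings_odd _ _ _ (b ord0) (a ord0))// mul0r.
Qed.

Lemma mx22_rows a c b d : mx22 a c b d =
  col_mx (row_mx (const_mx a : 'rV_1) (const_mx c : 'rV_1))
    (row_mx (const_mx b : 'rV_1) (const_mx d : 'rV_1)).
Proof. by []. Qed.

(** * Two by two matrices *)

Lemma mx22E a c b d :
  [/\ mx22 a c b d ord0 ord0 = a, mx22 a c b d ord0 ord_max = c,
      mx22 a c b d ord_max ord0 = b & mx22 a c b d ord_max ord_max = d].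
Proof.
have e0 : (ord0 : 'I_2) = lshift 1 (ord0 : 'I_1) by exact: val_inj.
have e1 : (ord_max : 'I_2) = rshift 1 (ord0 : 'I_1) by exact: val_inj.
have cE (y : nat) : (const_mx y : 'M[nat]_1) ord0 ord0 = y by rewrite mxE.
rewrite e0 e1 /mx22; split.
- by rewrite -[RHS]cE; exact: block_mxEul.
- by rewrite -[RHS]cE; exact: block_mxEur.
- by rewrite -[RHS]cE; exact: block_mxEdl.
- by rewrite -[RHS]cE; exact: block_mxEdr.
Qed.

Lemma big2 (T : Type) (idx : T) (op : Monoid.law idx) (F : 'I_2 -> T) :
  \big[op/idx]_(i < 2) F i = op (F ord0) (F ord_max).
Proof. by rewrite big_ord_recl big_ord1 ord_max2. Qed.

(** The quotient of phi by the integral. The factors at a + c and b + d have cancelled against those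
    of the row sums, and what remains is symmetric under exchanging b and c, that is, under
    transposition. *)
Definition ratio22 (n a c b d : nat) : R :=
  (dfact (a + c + (b + d) + n - 1))%:R *
  (dfact_shift R n a * dfact_shift R n b * dfact_shift R n c * dfact_shift R n d) /
  ((dfact (n - 2) * dfact (n - 1) *
    (dfact a * dfact b * dfact c * dfact d))%:R *
   (dfact_shift R n (a + d) * dfact_shift R n (b + c) * dfact_shift R n 0)).

Lemma wprod22 n a b c d :
  let f := dfact_shift R n in
  wprod f (('X^a + 'X^b - 1) * ('X^c + 'X^d - 1)) =
  f (a + c)%N * f (a + d)%N * f (b + c)%N * f (b + d)%N * f 0%N /
    (f a * f b * f c * f d).
Proof.
move=> f; have f0 : forall m, f m != 0 := @dfact_shift_neq0 R n.
rewrite (_ : _ * _ = 'X^(a + c) + 'X^(a + d) + 'X^(b + c) + 'X^(b + d) + 'X^0 -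
  ('X^a + 'X^b + 'X^c + 'X^d)); last by rewrite !exprD expr0; ring.
by rewrite !(wprodD, wprodN, wprodXn).
Qed.

Section TwoByTwo.
Variables (n : nat) (mu : probability (borel_mx R n) R) (mu_haar : is_haar mu).
Variable hn : (2 <= n)%N.

Lemma phi22_I a c b d :
  phi mu hn hn (mx22 a c b d) =
  I_int mu hn hn (mx22 a c b d) * ratio22 n a c b d.
Proof.
rewrite phi_formula// I_int_value// /phi_value /column_poly !big2.
have [-> -> -> ->] := mx22E a c b d.
rewrite /= wprod22 /ratio22 /=.
have f0 m : dfact_shift R n m != 0 := @dfact_shift_neq0 R n m.
have neq0 m : (dfact m)%:R != 0 :> R by rewrite pnatr_eq0 -lt0n dfact_gt0.
rewrite !natrM -/(dfact_shift R n (a + c)) -/(dfact_shift R n (b + d)).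
set be := beta _ _.
by field; rewrite !f0 !neq0.
Qed.

Lemma phi22_tr a c b d :
  phi mu hn hn (mx22 a c b d) = phi mu hn hn (mx22 a b c d).
Proof.
rewrite !phi22_I; congr (_ * _); last first.
  rewrite /ratio22.
  have -> : (a + b + (c + d) = a + c + (b + d))%N by lia.
  have -> : (c + b = b + c)%N by lia.
  have -> : (dfact a * dfact c * dfact b * dfact d =
    dfact a * dfact b * dfact c * dfact d)%N by lia.
  by congr (_ / _); ring.
rewrite /I_int.
have := @haar_mean_trmx R n mu mu_haar
  (fun u => \prod_(i < 2) \prod_(j < 2) u (widen_ord hn i) (widen_ord hn j) ^+ mx22 a b c d i j).
rewrite /haar_mean => <-; last first.
  do 2 (apply: polyfun_prod => ?); apply: polyfun_exp; exact: polyfun_coord.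
apply: eq_Rintegral => u _; rewrite !big2.
have [-> -> -> ->] := mx22E a c b d; have [-> -> -> ->] := mx22E a b c d.
by rewrite /= !mxE; ring.
Qed.

End TwoByTwo.

Lemma phi_rows_one_row n (a b : nat) : (2 <= n)%N ->
  let y := phi_rows n (row_mx (const_mx a : 'rV_1) (const_mx b : 'rV_1))
    (row_mx 0 0) in y = 0 \/ y = 1.
Proof.
move=> hn; have [oa|ea] := boolP (odd a).
  left; rewrite /phi_rows (big_row_mx _ _ _ _ _ (fun i j => pairing R i j)).
  by rewrite !big_ord1 !mxE pairing0r oa /= mul0r beta0 mul0r.
have [ob|eb] := boolP (odd b).
  by left; apply: (@phi_rows_odd_entry _ 1 1 _ _ _ ord0); rewrite mxE.
right; rewrite phi_rows_even => [|t]; last by rewrite mxE.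
rewrite big_ord1 mxE phi_rows_zero_row//; lia.
Qed.

(** Appending a zero column and transposing turns the column into a single row above a zero row. *)
Lemma phi_rows_one_column n (mu : probability (borel_mx R n) R)
    (mu_haar : is_haar mu) (hn : (2 <= n)%N) (a b : nat) :
  let y := phi_rows n (const_mx a : 'rV_1) (const_mx b : 'rV_1) in
  y = 0 \/ y = 1.
Proof.
have e0 (t : 'I_1) : ~~ odd ((const_mx 0 : 'rV[nat]_1) ord0 t) by rewrite mxE.
have := phi_rows_even n (const_mx a) (const_mx b) e0.
rewrite big_ord1 mxE addn0 => <-.
have := phi22_tr mu_haar hn a 0 b 0; rewrite !mx22_rows !phi_col// => ->.
exact: phi_rows_one_row.
Qed.

(* With [t] the determinant, (r, s) = (- t q, t p) and [t ^+ (b + d) = 1]. *)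
Lemma orthogonal2_monomial (p q r s : R) a b c d :
  p * p + q * q = 1 -> p * r + q * s = 0 -> r * r + s * s = 1 ->
  ~~ odd (b + d) ->
  p ^+ a * q ^+ c * (r ^+ b * s ^+ d) = (-1) ^+ b * (p ^+ (a + d) * q ^+ (b + c)).
Proof.
move=> pq pqrs rs ebd; pose t := p * s - q * r.
have sE : s = t * p.
  transitivity (s * (p * p + q * q) - q * (p * r + q * s)); last by rewrite /t; ring.
  by rewrite pqrs pq; ring.
have rE : r = - (t * q).
  transitivity (r * (p * p + q * q) - p * (p * r + q * s)); last by rewrite /t; ring.
  by rewrite pqrs pq; ring.
have t2 : t ^+ 2 = 1.
  transitivity ((p * p + q * q) * (r * r + s * s) - (p * r + q * s) ^+ 2).
    by rewrite /t; ring.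
  by rewrite pqrs pq rs; ring.
have tE : t ^+ b * t ^+ d = 1.
  by rewrite -exprD -(even_halfK ebd) -mul2n exprM t2 expr1n.
move: t sE rE tE {t2} => t -> -> tE.
rewrite (exprNn (t * q)) !exprMn !exprD.
transitivity ((-1) ^+ b * (t ^+ b * t ^+ d) * (p ^+ a * p ^+ d * (q ^+ b * q ^+ c))).
  move: ((-1) ^+ b) (t ^+ b) (t ^+ d) (p ^+ a) (p ^+ d) (q ^+ b) (q ^+ c).
  by move=> *; ring.
by rewrite tE mulr1.
Qed.

Lemma I_int2 (mu : probability (borel_mx R 2) R) (mu_haar : is_haar mu) a c b d :
  ~~ odd (b + d) ->
  I_int mu (leqnn 2) (leqnn 2) (mx22 a c b d) =
  (-1) ^+ b * I_int mu (leqnn 2) (leqnn 2) (mx22 (a + d) (b + c) 0 0).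
Proof.
move=> ebd; rewrite /I_int -/(haar_mean _ _) -[in RHS]/(haar_mean _ _) -haar_meanZ//; last first.
  do 2 (apply: polyfun_prod => ?); apply: polyfun_exp; exact: polyfun_coord.
apply: eq_haar_mean => u uu; rewrite !big2.
have [-> -> -> ->] := mx22E a c b d.
have [-> -> -> ->] := mx22E (a + d) (b + c) 0 0.
have w i : widen_ord (leqnn 2) i = i by exact: val_inj.
rewrite !w.
have := uu; rewrite /orthogonal_group /= => /matrixP uuE.
have := uuE ord0 ord0; have := uuE ord0 ord_max; have := uuE ord_max ord_max.
rewrite !mxE !big2 !mxE /=.
move=> rs pqrs pq.
by rewrite (@orthogonal2_monomial _ _ _ _ a b c d pq pqrs rs ebd) !expr0 !mulr1.
Qed.

(** For n = 2 the factor (m + n - 2)!! is m!!, so the entries themselves cancel and only the total,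
    a + d and b + c remain. *)
Lemma ratio22_dim2 a c b d : ratio22 2 a c b d = ratio22 2 (a + d) (b + c) 0 0.
Proof.
have fE m : dfact_shift R 2 m = (dfact m)%:R by rewrite /dfact_shift addnK.
have neq0 m : (dfact m)%:R != 0 :> R by rewrite pnatr_eq0 -lt0n dfact_gt0.
rewrite /ratio22 !fE !addn0 !natrM dfact0.
have -> : (a + d + (b + c) + 2 - 1 = a + c + (b + d) + 2 - 1)%N by lia.
by field; rewrite !neq0.
Qed.

Lemma phi_dim2 (mu : probability (borel_mx R 2) R) (mu_haar : is_haar mu) a b c d :
  let y := phi mu (leqnn 2) (leqnn 2) (mx22 a c b d) in
  y = -1 \/ y = 0 \/ y = 1.
Proof.
have [obd|ebd] := boolP (odd (b + d)).
  right; left; rewrite mx22_rows phi_col// phi_rows_odd//.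
  suff : odd (\sum_(t < 1 + 1) row_mx (const_mx b : 'rV_1) (const_mx d) ord0 t).
    by [].
  by rewrite big_split_ord /= !big_ord1 row_mxEl row_mxEr !mxE.
rewrite phi22_I// I_int2// ratio22_dim2 -mulrA -phi22_I//.
have := @phi_rows_one_row 2 (a + d) (b + c) isT.
rewrite mx22_rows phi_col//= => -[->|->]; first by rewrite mulr0; right; left.
by rewrite mulr1 -signr_odd; case: odd; [left|right; right].
Qed.

(** The permutations preserving all values are closed under products, hence under conjugation by a
    preserving transposition; the adjacent transpositions of (a, b, c, d) then generate
    everything. *)
Lemma phi22_perm n (mu : probability (borel_mx R n) R) (mu_haar : is_haar mu)
    (hn : (2 <= n)%N) (v : 'I_4 -> nat) (s : 'S_4) :
  let phi22 (w : 'I_4 -> nat) := phi mu hn hn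
    (mx22 (w (inord 0)) (w (inord 2)) (w (inord 1)) (w (inord 3))) in
  phi22 (fun i => v (s i)) = phi22 v.
Proof.
move=> F; pose P (s : 'S_4) := forall w, F (fun i => w (s i)) = F w.
suff : P s by exact.
have PM s1 s2 : P s1 -> P s2 -> P (s1 * s2)%g.
  move=> P1 P2 w; rewrite -(P2 w) -(P1 (fun i => w (s2 i))).
  by congr F; apply/funext => i; rewrite permM.
have P1 : P 1%g by move=> w; congr F; apply/funext => i; rewrite perm1.
have PJ i j t : P (tperm i j) -> P t -> P (t ^ tperm i j)%g.
  by move=> Pij Pt; rewrite /conjg tpermV; do 2 apply: (PM) => //.
pose o k : 'I_4 := inord k.
have oE k l : (k < 4)%N -> (l < 4)%N -> (o k == o l) = (k == l).
  by move=> k4 l4; rewrite -val_eqE /= !inordK.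
have tE i j k : tperm i j (o k) = if o k == i then j else if o k == j then i else o k.
  by rewrite permE.
(* Exchanging c and d flips the second column; exchanging b and c is transposition; exchanging a and
   b is a row exchange followed by a flip of the second column. *)
have P23 : P (tperm (o 2) (o 3)).
  move=> w; rewrite /F -!/(o _) !tE !oE//= !mx22_rows !phi_col//.
  exact: (@phi_rows_flip n 1 1).
have P12 : P (tperm (o 1) (o 2)).
  by move=> w; rewrite /F -!/(o _) !tE !oE//=; exact: phi22_tr.
have P01 : P (tperm (o 0) (o 1)).
  move=> w; rewrite /F -!/(o _) !tE !oE//= !mx22_rows !phi_col//.
  by rewrite phi_rowsC; exact: (@phi_rows_flip n 1 1).
(* The three remaining transpositions are conjugates of the adjacent ones. *)
have P02 : P (tperm (o 0) (o 2)).
  by have := PJ _ _ _ P01 P12; rewrite tpermJ !tE !oE.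
have P13 : P (tperm (o 1) (o 3)).
  by have := PJ _ _ _ P23 P12; rewrite tpermJ !tE !oE.
have P03 : P (tperm (o 0) (o 3)).
  by have := PJ _ _ _ P23 P02; rewrite tpermJ !tE !oE.
have Pt i j : P (tperm i j).
  have oK (k : 'I_4) : k = o k by rewrite /o inord_val.
  rewrite (oK i) (oK j); case: i j => [i i4] [j j4] /=.
  case: i i4 => [|[|[|[|//]]]] _; case: j j4 => [|[|[|[|//]]]] _;
    rewrite ?tperm1 //; by rewrite tpermC.
have [ts -> _] := prod_tpermP s.
elim: ts => [|t ts IH]; first by rewrite big_nil.
by rewrite big_cons; exact: PM.
Qed.

End PhiFormula.

(** * The nine properties *)

Theorem theorem5p6 (R : realType)
    (mu : forall n : nat, probability (borel_mx R n) R)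
    (mu_haar : forall n : nat, is_haar (mu n))
    (n : nat) (hn : (2 <= n)%N) :
  (* (1) *)
  (forall (q : nat) (hq : (q <= n)%N) (hq1 : (q + 1 <= n)%N)
     (a b : 'rV[nat]_q),
     phi (mu n) hn hq (col_mx a b) =
     phi (mu n) hn hq1 (block_mx a (0 : 'rV[nat]_1) b (0 : 'rV[nat]_1)))
  /\ (* (2) *)
  (forall (q : nat) (hq : (q <= n)%N) (a b : 'rV[nat]_q),
     phi (mu n) hn hq (col_mx a b) = phi (mu n) hn hq (col_mx b a))
  /\ (* (3) *)
  (forall (q : nat) (hq : (q <= n)%N) (x : 'M[nat]_(2, q)) (s : 'S_q),
     phi (mu n) hn hq (col_perm s x) = phi (mu n) hn hq x)
  /\ (* (4) *)
  (forall (q s : nat) (hqs : (q + s <= n)%N)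
     (a b : 'rV[nat]_q) (c d : 'rV[nat]_s),
     phi (mu n) hn hqs (block_mx a c b d) =
     phi (mu n) hn hqs (block_mx a d b c))
  /\ (* (5) *)
  (forall (q s : nat) (hqs : (q + s <= n)%N) (hq1 : (q + 1 <= n)%N)
     (a b : 'rV[nat]_q) (c : 'rV[nat]_s),
     (forall i : 'I_s, ~~ odd (c ord0 i)) ->
     phi (mu n) hn hqs (block_mx a c b (0 : 'rV[nat]_s)) =
     phi (mu n) hn hq1
       (block_mx a (const_mx (\sum_(i < s) c ord0 i)%N : 'rV[nat]_1)
                 b (0 : 'rV[nat]_1)))
  /\ (* (6) *)
  (forall (q c : nat) (hq1 : (q + 1 <= n)%N)
     (hnc : (2 <= n + c)%N) (hqc : (q <= n + c)%N) (a b : 'rV[nat]_q),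
     ~~ odd c ->
     phi (mu n) hn hq1
       (block_mx a (const_mx c : 'rV[nat]_1) b (0 : 'rV[nat]_1)) =
     phi (mu (n + c)%N) hnc hqc (col_mx a b))
  /\ (* (7) *)
  (forall (s : nat) (hs : (1 + s <= n)%N) (a b : nat) (c : 'rV[nat]_s),
     let y := phi (mu n) hn hs
       (block_mx (const_mx a : 'rV[nat]_1) c
                 (const_mx b : 'rV[nat]_1) (0 : 'rV[nat]_s)) in
     y = 0 \/ y = 1)
  /\ (* (8) *)
  (forall a b c d : nat,
     let y := phi (mu 2%N) (leqnn 2) (leqnn 2) (mx22 a c b d) in
     y = -1 \/ y = 0 \/ y = 1)
  /\ (* (9) *)
  (forall (v : 'I_4 -> nat) (s : 'S_4),
     let phi22 (w : 'I_4 -> nat) :=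
       phi (mu n) hn hn
         (mx22 (w (inord 0)) (w (inord 2)) (w (inord 1)) (w (inord 3))) in
     phi22 (fun i => v (s i)) = phi22 v).
Proof.
split=> [q hq hq1 a b|].
  (* A zero column is an even column that shifts the dimension by 0. *)
  rewrite phi_col// phi_block// phi_rows_even => [|t]; last by rewrite mxE.
  by rewrite big_ord1 mxE addn0.
split=> [q hq a b|]; first by rewrite !phi_col// phi_rowsC.
split=> [q hq x s|].
  rewrite !phi_formula// !phi_value_rows -[RHS](phi_rows_perm _ n _ _ s).
  by congr phi_rows; apply/rowP => t; rewrite !mxE.
split=> [q s hqs a b c d|]; first by rewrite !phi_block// phi_rows_flip.
split=> [q s hqs hq1 a b c ec|].
  (* Both sides become [phi_rows] in dimension n plus the sum of c. *)
  rewrite !phi_block// !phi_rows_even// => [|t].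
    by rewrite big_ord1 mxE.
  by rewrite mxE; elim/big_ind: _ => // m1 m2 e1 e2; rewrite oddD (negPf e1).
split=> [q c hq1 hnc hqc a b ec|].
  rewrite phi_block// phi_col// phi_rows_even => [|t]; last by rewrite mxE.
  by rewrite big_ord1 mxE.
split=> [s hs a b c|].
  rewrite phi_block//.
  (* An odd entry above a zero gives the value 0; otherwise all columns of c are absorbed into the
     dimension and a single column is left. *)
  have [ec|] := boolP [forall t, ~~ odd (c ord0 t)]; last first.
    rewrite negb_forall => /existsP[t]; rewrite negbK => oc.
    by left; exact: phi_rows_odd_entry oc.
  rewrite phi_rows_even; last exact/forallP.
  by apply: (phi_rows_one_column (mu_haar _)); rewrite (leq_trans hn)// leq_addr.
split=> [a b c d|v s]; first exact: phi_dim2.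
exact: phi22_perm.
Qed.
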